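(* Let $Z:\mathcal P\to\mathbb R$ be $\mathcal C^2$, with $Z$ $L_0$-Lipschitz, $\nabla Z$ $L_1$-Lipschitz and $\nabla^2Z$ $L_2$-Lipschitz on $\mathcal P$ (all with respect to $\|\cdot\|$), and for each $\mathbf q\in\mathcal P$ let the noisy evaluation $\hat Z(\mathbf q)$ satisfy $E[\hat Z(\mathbf q)]=Z(\mathbf q)$ and $\mathrm{Var}[\hat Z(\mathbf q)]\le\sigma^2$, with $\sigma^2>0$ a constant. Let $\mathbf p\in\mathcal P$, $c\in(0,1]$, $R\ge 1$, let $\boldsymbol\delta$ be a random vector in $\mathcal P$ and let $S(\mathbf p,\boldsymbol\delta)=\gamma(\boldsymbol\delta-\mathbf p)$ with $\gamma\in\mathbb R$, chosen such that $$\text{(MC1)}\quad E[S(\mathbf p,\boldsymbol\delta)]=\mathbf 0,\qquad \text{(MC2)}\quad E[(\boldsymbol\delta-\mathbf p)S(\mathbf p,\boldsymbol\delta)']=\mathbf I-\lambda\mathbf 1\mathbf 1'\ \text{ for some }\lambda\in\mathbb R.$$ Let $\hat\psi_{SFE}=\frac1R\sum_{j=1}^R\frac{\hat Z^j((1-c)\mathbf p+c\boldsymbol\delta^j)}{c}S(\mathbf p,\boldsymbol\delta^j)$ and $\psi_{SFE}=E[\hat\psi_{SFE}]$. Then $$\psi_{SFE}-\nabla Z(\mathbf p)-\epsilon_0\mathbf 1=\boldsymbol\epsilon,\qquad \epsilon_0=-\frac{\nabla Z(\mathbf p)'\mathbf 1}{n},\qquad \|\boldsymbol\epsilon\|=O(ncM_2+nc^2L_2),$$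 and $$E[\|\hat\psi_{SFE}-\psi_{SFE}\|^2]=O\Big(\frac{\gamma n}{Rc^2}\,[\sigma^2+M_0^2]\Big).$$ Moreover, if in addition (MC3) holds, i.e. there is $\mu\in\mathbb R$ with $E[(\boldsymbol\delta-\mathbf p)_i(\boldsymbol\delta-\mathbf p)_jS(\mathbf p,\boldsymbol\delta)_k]=\mu$ for all $i,j,k\in\{1,\dots,n\}$, then $$\psi_{SFE}-\nabla Z(\mathbf p)-\epsilon_0\mathbf 1=\boldsymbol\epsilon,\qquad \epsilon_0=\frac{c\mu}{2}\mathbf 1'\nabla^2Z(\mathbf p)\mathbf 1-\frac{\nabla Z(\mathbf p)'\mathbf 1}{n},\qquad \|\boldsymbol\epsilon\|=O(nc^2L_2).$$
   Context: $n\ge2$; $\mathcal P=\{\mathbf p\in\mathbb R^n: \sum_i p_i=1,\ p_i\ge 0\}$ is the probability simplex. $\|\cdot\|$ is the Euclidean norm of vectors and the spectral norm of matrices, $\mathbf 1$ is the all-ones vector, $\mathbf I$ the identity matrix, $\mathbf e_i$ the $i$-th standard basis vector, and $'$ denotes transpose. Derivatives on the simplex. A function $F:\mathcal P\to\mathbb R$ is differentiable at $\mathbf p$ if there is a vector $\nabla F(\mathbf p)$ with $F(\mathbf q)-F(\mathbf p)=\nabla F(\mathbf p)'(\mathbf q-\mathbf p)+o(\|\mathbf q-\mathbf p\|)$ for $\mathbf q\in\mathcal P$; such a vector is unique only up to adding multiples of $\mathbf 1$, and $\nabla F(\mathbf p)=(F_1(\mathbf p),\dots,F_n(\mathbf p))'$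 always denotes the version $F_i(\mathbf p)=\lim_{\epsilon\to0_+}\frac{F((1-\epsilon)\mathbf p+\epsilon\mathbf e_i)-F(\mathbf p)}{\epsilon}$. Higher derivatives are defined recursively by $F_{i_1,\dots,i_{k+1}}=(F_{i_1,\dots,i_k})_{i_{k+1}}$, and $\nabla^2F(\mathbf p)=(F_{i,j}(\mathbf p))_{i,j}$. $F$ is $\mathcal C^k$ if its derivatives of order up to $k$ exist in this sense and are continuous on $\mathcal P$. Set $M_0=\sup_{\mathcal P}|Z|$, $M_1=\sup_{\mathcal P}\|\nabla Z\|$, $M_2=\sup_{\mathcal P}\|\nabla^2Z\|$, which are finite. $\boldsymbol\delta^1,\dots,\boldsymbol\delta^R$ are i.i.d. copies of $\boldsymbol\delta$, and $\hat Z^1(\cdot),\hat Z^2(\cdot),\dots$ are mutually independent function evaluations, independent of the $\boldsymbol\delta^j$. $O(X)$ means bounded by an absolute constant times $X$ (independent of $n,c,R,\gamma,\mathbf p,Z$, the noise and the law of $\boldsymbol\delta$). *)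

(* Defs.v *)
From HB Require Import structures.
From mathcomp Require Import all_boot all_order all_algebra.
From mathcomp Require Import all_classical all_reals all_analysis.

Set Implicit Arguments.
Unset Strict Implicit.
Unset Printing Implicit Defensive.

Import Order.TTheory GRing.Theory Num.Theory.
Import numFieldNormedType.Exports.

Local Open Scope classical_set_scope.
Local Open Scope ring_scope.

Section Euclidean.
Context {R : realType}.

Definition dot n (u v : 'cV[R]_n) : R := (u^T *m v) 0 0.

(* The library norm on matrices is the sup norm. *)
Definition enorm n (v : 'cV[R]_n) : R := Num.sqrt (dot v v).

Definition spnorm m n (A : 'M[R]_(m, n)) : R :=
  sup [set enorm (A *m v) | v in [set v | enorm v <= 1]].

Definition ones n : 'cV[R]_n := const_mx 1.

Definition simplex n : set 'cV[R]_n :=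
  [set p | dot (@ones n) p = 1 /\ forall i, 0 <= p i 0].

(* Lipschitz on the simplex, for the Euclidean norm on the domain and for the
   norm N on the codomain. *)
Definition simplex_lipschitz n (V : zmodType) (N : V -> R) (L : R)
    (F : 'cV[R]_n -> V) : Prop :=
  forall p q, simplex p -> simplex q -> N (F p - F q) <= L * enorm (p - q).

End Euclidean.

Arguments ones {R} n.
Arguments simplex {R n}.

(* A real function on the simplex is represented by a total function on column
   vectors; everything below depends only on its values on the simplex. *)
Section Derivatives.
Context {R : realType} {n : nat}.
Implicit Types (F : 'cV[R]_n -> R) (p : 'cV[R]_n).

Definition simplex_differentiable F p : Prop :=
  exists g : 'cV[R]_n, forall q,
    F q - F p - dot g (q - p)
      =o_(q \near within simplex (nbhs p)) enorm (q - p).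

(* The derivative towards the i-th vertex.  This normalization selects one
   gradient among those of simplex_differentiable, which differ by multiples of
   the all-ones vector. *)
Definition pderiv F (i : 'I_n) p : R :=
  lim ((fun e : R => (F ((1 - e) *: p + e *: delta_mx i 0) - F p) / e) @ 0^'+).

Definition grad F p : 'cV[R]_n := \col_i pderiv F i p.

Definition hess F p : 'M[R]_n := \matrix_(i, j) pderiv (pderiv F i) j p.

Fixpoint simplex_Ck (k : nat) F : Prop :=
  {within simplex, continuous F} /\
  if k is k'.+1 then
    (forall p, simplex p -> simplex_differentiable F p) /\
    (forall i, simplex_Ck k' (pderiv F i))
  else True.

End Derivatives.

Notation borel_cV R n := (g_sigma_algebraType (@open 'cV[R]_n)).

Section Probability.
Context {d : measure_display} {T : measurableType d} {R : realType}
  (P : probability T R).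

(* M is the entrywise expectation of the random matrix X.  As M is finite, this
   entails that the entries of X are integrable (when they are measurable). *)
Definition has_mean m n (X : T -> 'M[R]_(m, n)) (M : 'M[R]_(m, n)) : Prop :=
  forall i j, ('E_P[fun t => X t i j] = (M i j)%:E)%E.

Definition mutually_independent (I : finType) (G : I -> set (set T)) : Prop :=
  forall (J : {set I}) (A : I -> set T),
    (forall i, i \in J -> G i (A i)) ->
    P (\bigcap_(i in [set` J]) A i) = (\prod_(i in J) P (A i))%E.

Definition sigma_of d' (T' : measurableType d') (X : T -> T') : set (set T) :=
  preimage_set_system [set: T] X measurable.

End Probability.

Definition score {R : realType} {n : nat} (gamma : R) (p x : 'cV[R]_n) :
  'cV[R]_n := gamma *: (x - p).

Definition sfe {R : realType} {n N : nat} {T : Type} (p : 'cV[R]_n)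
    (c gamma : R) (Zhat : 'I_N -> 'cV[R]_n -> T -> R)
    (delta : 'I_N -> T -> 'cV[R]_n) (t : T) : 'cV[R]_n :=
  N%:R^-1 *: \sum_(j < N)
    (Zhat j ((1 - c) *: p + c *: delta j t) t / c) *: score gamma p (delta j t).

(* Main.v *)
(* Write D = delta - p.  The mean value theorem, applied twice along the segment
   from p to p + c D, gives
     Z (p + c D) = Z p + c dZ.D + (c^2 / 2) D'HD + O(L2 |c D|^3).
   Multiply by the score gamma D / c and integrate.  (MC1) removes the constant
   term.  Since 1'D = 0, (MC2) forces lambda = 1 / n and turns the linear term
   into dZ - (dZ.1 / n) 1.  The trace of (MC2) is gamma E|D|^2 = n - 1, so
   gamma > 0, and as |D|^2 <= 2 this controls the quadratic and the remainder
   terms after pairing with a test vector.  Under (MC3) the quadratic term is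
   exactly a multiple of 1.
   For the variance, the N summands have the same mean and are uncorrelated, so
   the mean square error is at most 1 / N times the second moment of one summand;
   integrating first over the noise, with delta fixed, bounds that second moment
   by (gamma / c)^2 (sigma^2 + M0^2) E|D|^2 = (gamma / c^2) (n - 1) (sigma^2 + M0^2). *)

Require Import Defs.
From HB Require Import structures.
From mathcomp Require Import all_boot all_order all_algebra.
From mathcomp Require Import all_classical all_reals all_analysis.
From mathcomp Require Import measurable_realfun ring lra.

Set Implicit Arguments.
Unset Strict Implicit.
Unset Printing Implicit Defensive.

Import Order.TTheory GRing.Theory Num.Theory.
Import numFieldNormedType.Exports.

Local Open Scope classical_set_scope.
Local Open Scope ring_scope.

(** * Euclidean and spectral norms *)

(** Two obstacles shape the proof. [Z] and [zeta] are controlled only on the simplex, while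
    integration needs measurable functions on a whole space; hence the extensions by zero, which are
    harmless because the copies stay in the simplex at every outcome. And a gradient on the simplex
    is fixed only up to a multiple of the all-ones vector; derivatives are therefore paired with
    directions of coordinate sum zero, where this ambiguity disappears. The linear growth in [n] has
    one source: the score brings one factor [|D|], the Taylor terms at least one more, and
    [gamma |D|^2] integrates to [n - 1]; the powers of [|D|] left over are bounded by constants.
    Mutual independence is given for copies and noises one by one, whereas a summand depends on a
    pair. A pi-system argument passes to pairs, and uniqueness of the product measure with Tonelli's
    theorem makes precise the integration over the noise with [delta] fixed. Finally, the moment
    conditions live on the space of [delta] and the estimator on another one, so that expectations
    are carried across by equality of laws. *)

Section Euclid.
Context {R : realType}.
Implicit Types n m : nat.

Lemma dotE n (u v : 'cV[R]_n) : dot u v = \sum_i u i 0 * v i 0.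
Proof. by rewrite /dot mxE; apply: eq_bigr => i _; rewrite mxE. Qed.

Lemma dotC n (u v : 'cV[R]_n) : dot u v = dot v u.
Proof. by rewrite !dotE; apply: eq_bigr => i _; rewrite mulrC. Qed.

Lemma dotDr n (u v w : 'cV[R]_n) : dot u (v + w) = dot u v + dot u w.
Proof. by rewrite /dot mulmxDr mxE. Qed.

Lemma dotZr n a (u v : 'cV[R]_n) : dot u (a *: v) = a * dot u v.
Proof. by rewrite /dot -scalemxAr mxE. Qed.

Lemma dotNr n (u v : 'cV[R]_n) : dot u (- v) = - dot u v.
Proof. by rewrite /dot mulmxN mxE. Qed.

Lemma dotDl n (u v w : 'cV[R]_n) : dot (v + w) u = dot v u + dot w u.
Proof. by rewrite dotC dotDr !(dotC u). Qed.

Lemma dotZl n a (u v : 'cV[R]_n) : dot (a *: v) u = a * dot v u.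
Proof. by rewrite dotC dotZr (dotC u). Qed.

Lemma dotNl n (u v : 'cV[R]_n) : dot (- v) u = - dot v u.
Proof. by rewrite dotC dotNr (dotC u). Qed.

Lemma dotvv_ge0 n (v : 'cV[R]_n) : 0 <= dot v v.
Proof. by rewrite dotE; apply: sumr_ge0 => i _; rewrite -expr2 sqr_ge0. Qed.

Lemma dotvv_eq0 n (v : 'cV[R]_n) : dot v v = 0 -> v = 0.
Proof.
rewrite dotE => /eqP; rewrite psumr_eq0; last first.
  by move=> i _; rewrite -expr2 sqr_ge0.
move=> /allP v0; apply/matrixP => i j; rewrite ord1 !mxE.
by have := v0 i (mem_index_enum i); rewrite /= mulf_eq0 orbb => /eqP.
Qed.

Lemma enorm_ge0 n (v : 'cV[R]_n) : 0 <= enorm v.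
Proof. exact: sqrtr_ge0. Qed.

Lemma sqr_enorm n (v : 'cV[R]_n) : enorm v ^+ 2 = dot v v.
Proof. by rewrite /enorm sqr_sqrtr// dotvv_ge0. Qed.

Lemma enorm_eq0 n (v : 'cV[R]_n) : enorm v = 0 -> v = 0.
Proof. by move=> v0; apply: dotvv_eq0; rewrite -sqr_enorm v0 expr0n. Qed.

Lemma enorm0 n : enorm (0 : 'cV[R]_n) = 0.
Proof. by rewrite /enorm /dot mulmx0 mxE sqrtr0. Qed.

Lemma enormZ n a (v : 'cV[R]_n) : enorm (a *: v) = `|a| * enorm v.
Proof.
by rewrite /enorm dotZl dotZr mulrA -expr2 sqrtrM ?sqr_ge0// sqrtr_sqr.
Qed.

Lemma enormN n (v : 'cV[R]_n) : enorm (- v) = enorm v.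
Proof. by rewrite -scaleN1r enormZ normrN1 mul1r. Qed.

Lemma dot_le_enorm n (u v : 'cV[R]_n) : dot u v <= enorm u * enorm v.
Proof.
have [/enorm_eq0 ->|u0] := eqVneq (enorm u) 0.
  by rewrite enorm0 /dot trmx0 mul0mx mxE mul0r.
have [/enorm_eq0 ->|v0] := eqVneq (enorm v) 0.
  by rewrite enorm0 /dot mulmx0 mxE mulr0.
(* With [a = enorm u] and [b = enorm v] this square expands to [2 a b (a b - dot u v)], and [a b] is
   positive here. *)
have := dotvv_ge0 (enorm v *: u - enorm u *: v).
rewrite !(dotDl, dotDr, dotNl, dotNr, dotZl, dotZr) (dotC v u) -!sqr_enorm.
have : 0 < enorm u * enorm v by rewrite mulr_gt0// lt_neqAle eq_sym ?u0 ?v0 enorm_ge0.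
nra.
Qed.

Lemma normr_dot_le n (u v : 'cV[R]_n) : `|dot u v| <= enorm u * enorm v.
Proof.
by rewrite ler_norml dot_le_enorm andbT lerNl -dotNl -(enormN u) dot_le_enorm.
Qed.

(** The test vector [u] itself suffices. This reduces the norm of a vector of integrals to a bound
    on scalar integrals. *)
Lemma enorm_le_dual n (u : 'cV[R]_n) b : 0 <= b ->
  (forall v, dot u v <= b * enorm v) -> enorm u <= b.
Proof.
move=> b0 /(_ u); rewrite -sqr_enorm expr2.
have [->//|u0] := eqVneq (enorm u) 0.
by rewrite ler_pM2r// lt_neqAle eq_sym u0 enorm_ge0.
Qed.

(** A real [sup] is informative only on a bounded set. Cauchy-Schwarz on each row gives the
    Frobenius norm as a bound. *)
Lemma spnorm_has_ubound m n (A : 'M[R]_(m, n)) :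
  has_ubound [set enorm (A *m v) | v in [set v | enorm v <= 1]].
Proof.
exists (Num.sqrt (\sum_i enorm (row i A)^T ^+ 2)) => _ [v /= v1 <-].
apply: ler_wsqrtr; rewrite dotE; apply: ler_sum => i _; rewrite -expr2.
have -> : (A *m v) i 0 = dot (row i A)^T v.
  by rewrite /dot trmxK -row_mul [RHS]mxE.
rewrite -real_normK ?num_real// ler_sqr ?nnegrE ?enorm_ge0//.
by rewrite (le_trans (normr_dot_le _ _))// ler_piMr// enorm_ge0.
Qed.

Lemma spnorm_ge0 m n (A : 'M[R]_(m, n)) : 0 <= spnorm A.
Proof.
apply: (ub_le_sup (spnorm_has_ubound A)); exists 0 => /=.
  by rewrite enorm0.
by rewrite mulmx0 enorm0.
Qed.

Lemma enorm_mulmx_le m n (A : 'M[R]_(m, n)) v :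
  enorm (A *m v) <= spnorm A * enorm v.
Proof.
have [/enorm_eq0 ->|v0] := eqVneq (enorm v) 0.
  by rewrite mulmx0 !enorm0 mulr0.
have vgt0 : 0 < enorm v by rewrite lt_neqAle eq_sym v0 enorm_ge0.
rewrite -ler_pdivrMr// mulrC.
rewrite -[X in X * _]ger0_norm ?invr_ge0 ?enorm_ge0// -enormZ scalemxAr.
apply: (ub_le_sup (spnorm_has_ubound A)); exists ((enorm v)^-1 *: v) => //=.
by rewrite enormZ ger0_norm ?invr_ge0 ?enorm_ge0// mulVf.
Qed.

Lemma normr_qform_le n (A : 'M[R]_n) (v : 'cV[R]_n) :
  `|dot v (A *m v)| <= spnorm A * enorm v ^+ 2.
Proof.
rewrite (le_trans (normr_dot_le _ _))// mulrC expr2 mulrA.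
by rewrite ler_wpM2r ?enorm_ge0// enorm_mulmx_le.
Qed.

End Euclid.

(** * Geometry of the simplex and derivatives along its segments *)

Section Simplex.
Context {R : realType} {n : nat}.
Implicit Types (p q v : 'cV[R]_n) (F : 'cV[R]_n -> R).

Lemma simplex_sum p : simplex p -> \sum_i p i 0 = 1.
Proof.
by move=> [+ _]; rewrite dotE => <-; apply: eq_bigr => i _; rewrite mxE mul1r.
Qed.

Lemma simplex_le1 p i : simplex p -> p i 0 <= 1.
Proof.
move=> sp; rewrite -(simplex_sum sp) (bigD1 i)//= lerDl sumr_ge0// => j _.
exact: sp.2.
Qed.

Lemma simplex_sumB p q : simplex p -> simplex q -> \sum_i (q - p) i 0 = 0.
Proof.
move=> sp sq; under eq_bigr do rewrite !mxE.
by rewrite sumrB !simplex_sum// subrr.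
Qed.

Lemma simplex_segment p q t : simplex p -> simplex q -> 0 <= t <= 1 ->
  simplex (p + t *: (q - p)).
Proof.
move=> [p1 p0] [q1 q0] /andP[t0 t1]; split.
  by rewrite dotDr dotZr dotDr dotNr p1 q1 subrr mulr0 addr0.
by move=> i; rewrite !mxE; have := p0 i; have := q0 i; nra.
Qed.

Lemma simplex_vertex i : simplex (delta_mx i 0 : 'cV[R]_n).
Proof.
split; last by move=> j; rewrite mxE; exact: ler0n.
rewrite dotE (bigD1 i)//= big1 => [|j ji]; rewrite !mxE ?eqxx ?mulr1 ?addr0//.
by rewrite (negPf ji) mulr0.
Qed.

Lemma sqr_enorm_simplexB p q : simplex p -> simplex q -> enorm (q - p) ^+ 2 <= 2.
Proof.
move=> sp sq; rewrite sqr_enorm dotE.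
have -> : 2 = \sum_i (q i 0 + p i 0) :> R by rewrite big_split/= !simplex_sum.
apply: ler_sum => i _; rewrite !mxE.
have := sp.2 i; have := sq.2 i; have := simplex_le1 i sp; have := simplex_le1 i sq.
nra.
Qed.

(** The filter [G] is left general so as to cover both the one-sided limit that defines [pderiv] and
    the two-sided derivative inside a segment. *)
Lemma cvg_difference_quotient F (g v : 'cV[R]_n) p (G : set_system R) :
  Filter G -> G --> 0^' -> (\forall h \near G, simplex (p + h *: v)) ->
  (forall q, F q - F p - dot g (q - p)
     =o_(q \near within simplex (nbhs p)) enorm (q - p)) ->
  (fun h => (F (p + h *: v) - F p) / h) @ G --> dot g v.
Proof.
move=> FG G0 Gs Fg; apply/cvgrPdist_le => e e0.
(* The [+ 1] keeps the denominator positive when [v = 0]. *)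
have e'0 : 0 < e / (enorm v + 1) by rewrite divr_gt0// ltr_wpDl ?enorm_ge0.
have {}Fg : \forall q \near within simplex (nbhs p),
    `|F q - F p - dot g (q - p)| <= e / (enorm v + 1) * `|enorm (q - p)|.
  by move/funext/eqoP : Fg; apply.
have cv : (fun h : R => p + h *: v) @ G --> p.
  have G0' : G --> (0 : R) by apply: cvg_trans G0 _; exact: nbhs_dnbhs.
  rewrite -[X in _ --> X]addr0 -(scale0r v).
  by apply: cvgD; [exact: cvg_cst|apply: cvgZr_tmp].
have h0 : \forall h \near G, h != 0 by apply: (G0 [set h | h != 0]); exact: withinT.
near=> h.
have hn0 : h != 0 by near: h.
rewrite -normrN opprB.
have -> : (F (p + h *: v) - F p) / h - dot g v =
    (F (p + h *: v) - F p - dot g (p + h *: v - p)) / h.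
  rewrite [p + _]addrC addrK dotZr; field; exact: hn0.
rewrite normrM normfV ler_pdivrMr ?normr_gt0//.
have : `|F (p + h *: v) - F p - dot g (p + h *: v - p)| <=
  e / (enorm v + 1) * `|enorm (p + h *: v - p)|.
  near: h; apply: filterS2 Gs (cv _ Fg) => h /= H1 H2.
  exact: H2.
move=> /le_trans; apply.
rewrite [p + _]addrC addrK ger0_norm ?enorm_ge0// enormZ.
rewrite -mulrA ler_pM2l// mulrCA ler_piMr//.
by rewrite mulrC ler_pdivrMr ?ltr_wpDl ?enorm_ge0// mul1r lerDl.
Unshelve. all: by end_near. Qed.

(** The derivative towards vertex [i] is [g i 0 - dot g p], so [grad F p] is [g] minus a multiple of
    the all-ones vector, which [v] annihilates. *)
Lemma dot_grad F p g v : simplex p ->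
  (forall q, F q - F p - dot g (q - p)
     =o_(q \near within simplex (nbhs p)) enorm (q - p)) ->
  \sum_i v i 0 = 0 -> dot (grad F p) v = dot g v.
Proof.
move=> sp Fg v0.
have gE i : pderiv F i p = dot g (delta_mx i 0 - p).
  rewrite /pderiv; apply/cvg_lim; first exact: norm_hausdorff.
  have -> : (fun e : R => (F ((1 - e) *: p + e *: delta_mx i 0) - F p) / e) =
      (fun e : R => (F (p + e *: (delta_mx i 0 - p)) - F p) / e).
    apply/funext => e; congr ((F _ - _) / _).
    by rewrite scalerBl scale1r scalerBr addrAC addrA.
  apply: cvg_difference_quotient Fg.
    move=> A A0; suff : \forall x \near (0 : R), 0 < x -> A x by [].
    have : \forall x \near (0 : R), x != 0 -> A x by exact: A0.
    by apply: filterS => x Ax x0; apply: Ax; rewrite gt_eqF.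
  near=> e; apply: simplex_segment => //; first exact: simplex_vertex.
  by apply/andP; split; near: e; [exact: nbhs_right_ge|exact: nbhs_right_le].
have dg i : dot g (delta_mx i 0) = g i 0.
  rewrite dotE (bigD1 i)//= big1 ?addr0 => [|j ji]; rewrite mxE ?eqxx ?mulr1//.
  by rewrite (negPf ji) mulr0.
rewrite dotE; under eq_bigr => i _ do rewrite mxE gE dotDr dotNr dg mulrBl.
by rewrite sumrB -mulr_sumr v0 mulr0 subr0 dotE.
Unshelve. all: by end_near. Qed.

Lemma is_derive_segment F p q t : simplex p -> simplex q -> 0 < t < 1 ->
  simplex_differentiable F (p + t *: (q - p)) ->
  is_derive t 1 (fun s : R => F (p + s *: (q - p)))
    (dot (grad F (p + t *: (q - p))) (q - p)).
Proof.
move=> sp sq /andP[t0 t1] [g Fg].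
have tI : 0 <= t <= 1 by rewrite !ltW.
rewrite (dot_grad _ Fg) ?simplex_sumB//; last exact: simplex_segment.
(* At an interior [t], small increments of both signs stay in the simplex; this is what makes the
   derivative two-sided. *)
have near0 : \forall h \near 0^', simplex (p + t *: (q - p) + h *: (q - p)).
  near=> h; rewrite -addrA -scalerDl; apply: simplex_segment => //.
  have : `|h| < Num.min t (1 - t).
    near: h; apply: dnbhs0_lt; by rewrite lt_min t0 subr_gt0.
  rewrite lt_min => /andP[]; rewrite !ltr_norml => /andP[? ?] /andP[? ?].
  by apply/andP; split; lra.
have := cvg_difference_quotient (dnbhs_filter _) cvg_id near0 Fg.
set Q := (X in X @ _ --> _) => Qc.
have QE : (fun h : R => h^-1 *: (((fun s : R => F (p + s *: (q - p))) \o shift t) (h *: 1) -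
     F (p + t *: (q - p)))) = Q.
  apply/funext => h; rewrite /Q /= [LHS]mulrC.
  by rewrite /GRing.scale /= mulr1 [h + t]addrC -addrA -scalerDl.
apply: DeriveDef.
  by apply/cvg_ex; exists (dot g (q - p)); rewrite QE.
by apply/cvg_lim; [exact: norm_hausdorff|rewrite QE].
Unshelve. all: by end_near. Qed.

End Simplex.

(** * Boundedness and constants of Lipschitz functions on the simplex *)

Section Bounds.
Context {R : realType}.

Lemma ler_enormD n (u v : 'cV[R]_n) : enorm (u + v) <= enorm u + enorm v.
Proof.
rewrite -ler_sqr ?nnegrE ?addr_ge0 ?enorm_ge0//.
rewrite sqr_enorm sqrrD !(dotDl, dotDr) (dotC v u) -!sqr_enorm.
have := dot_le_enorm u v; lra.
Qed.

Lemma ler_spnormD m n (A B : 'M[R]_(m, n)) : spnorm (A + B) <= spnorm A + spnorm B.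
Proof.
apply: ge_sup; first by exists (enorm ((A + B) *m 0)), 0 => //=; rewrite enorm0.
move=> _ [v /= v1 <-]; rewrite mulmxDl (le_trans (ler_enormD _ _))//.
have vle (C : 'M[R]_(m, n)) : enorm (C *m v) <= spnorm C.
  by rewrite (le_trans (enorm_mulmx_le _ _))// ler_piMr// spnorm_ge0.
exact: lerD.
Qed.

(** The simplex has diameter at most the square root of 2. This makes the suprema [M0] and [M2]
    genuine upper bounds. *)
Lemma simplex_lipschitz_has_ubound n (V : zmodType) (N : V -> R) L
    (F : 'cV[R]_n -> V) : (forall x y, N (x + y) <= N x + N y) ->
  simplex_lipschitz N L F -> has_ubound [set N (F q) | q in simplex].
Proof.
move=> ND NL.
have [[p sp]|ns] := pselect (exists p : 'cV[R]_n, simplex p); last first.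
  by exists 0 => x [q sq _]; case: ns; exists q.
exists (N (F p) + `|L| * Num.sqrt 2) => _ [q sq <-].
rewrite -[F q](subrK (F p)) addrC (le_trans (ND _ _))// lerD2l.
rewrite (le_trans (NL _ _ sq sp))// (le_trans (ler_norm _))//.
rewrite normrM ler_wpM2l// ger0_norm ?enorm_ge0//.
rewrite -[leLHS]ger0_norm ?enorm_ge0// -sqrtr_sqr ler_wsqrtr//.
exact: sqr_enorm_simplexB.
Qed.

(** Two distinct vertices lie at positive distance; a one-point simplex would not exclude a negative
    [L]. *)
Lemma simplex_lipschitz_ge0 n (V : zmodType) (N : V -> R) L
    (F : 'cV[R]_n -> V) : (1 < n)%N -> (forall x, 0 <= N x) ->
  simplex_lipschitz N L F -> 0 <= L.
Proof.
move=> n1 N0 NL.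
pose i : 'I_n := Ordinal (ltnW n1); pose j : 'I_n := Ordinal n1.
have := NL _ _ (simplex_vertex i) (simplex_vertex j).
move=> /(le_trans (N0 _)); rewrite pmulr_lge0//.
rewrite lt_neqAle enorm_ge0 andbT; apply/negP => /eqP/esym/enorm_eq0.
move=> /matrixP/(_ i 0); rewrite !mxE eqxx/= => /eqP.
by rewrite subr0 oner_eq0.
Qed.

End Bounds.

(** * Taylor expansion along segments of the simplex *)

Section Taylor.
Context {R : realType} {n : nat}.
Implicit Types (p q v : 'cV[R]_n) (F Z : 'cV[R]_n -> R).

Lemma continuous_segment F p q (a b : R) : simplex p -> simplex q ->
  0 <= a -> b <= 1 -> {within simplex, continuous F} ->
  {within `[a, b], continuous (fun s : R => F (p + s *: (q - p)))}.
Proof.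
move=> sp sq a0 b1 /subspace_continuousP Fc; apply/subspace_continuousP => s.
have sI (t : R) : `[a, b]%classic t -> simplex (p + t *: (q - p)).
  rewrite /= in_itv/= => /andP[at_ tb]; apply: simplex_segment => //.
  by rewrite (le_trans a0 at_) (le_trans tb b1).
move=> sab; apply: cvg_comp (Fc _ (sI _ sab)).
move=> A A0; suff : \forall t \near s, `[a, b]%classic t -> A (p + t *: (q - p)) by [].
have {}A0 : \forall x \near (p + s *: (q - p)), simplex x -> A x by exact: A0.
have cv : (fun t : R => p + t *: (q - p)) @ s --> p + s *: (q - p).
  by apply: cvgD; [exact: cvg_cst|apply: cvgZr_tmp].
have : \forall t \near s, simplex (p + t *: (q - p)) -> A (p + t *: (q - p)).
  exact: cv _ A0.
by apply: filterS => t At tab; exact/At/sI.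
Qed.

(** Row [i] of [hess Z] is the gradient of [pderiv Z i], so the first-order statement applies to
    each component. *)
Lemma is_derive_grad_segment Z p q (t : R) : simplex_Ck 2 Z -> simplex p -> simplex q ->
  0 < t < 1 ->
  is_derive t 1 (fun s : R => dot (grad Z (p + s *: (q - p))) (q - p))
    (dot (q - p) (hess Z (p + t *: (q - p)) *m (q - p))).
Proof.
move=> [_ [_ Z1]] sp sq t01.
have -> : (fun s : R => dot (grad Z (p + s *: (q - p))) (q - p)) =
    \sum_i (fun s : R => (q - p) i 0 *: pderiv Z i (p + s *: (q - p))).
  apply/funext => s; rewrite fct_sumE dotE; apply: eq_bigr => i _.
  by rewrite [grad _ _ _ _]mxE mulrC.
rewrite dotE; apply: is_derive_sum => i.
have -> : (hess Z (p + t *: (q - p)) *m (q - p)) i 0 =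
    dot (grad (pderiv Z i) (p + t *: (q - p))) (q - p).
  by rewrite dotE !mxE; apply: eq_bigr => j _; rewrite !mxE.
apply: is_deriveZ; apply: is_derive_segment => //.
apply: (Z1 i).2.1; apply: simplex_segment => //.
by case/andP: t01 => /ltW -> /ltW ->.
Qed.

Lemma continuous_grad_segment Z p q (a b : R) : simplex_Ck 1 Z -> simplex p -> simplex q ->
  0 <= a -> b <= 1 ->
  {within `[a, b], continuous (fun s : R => dot (grad Z (p + s *: (q - p))) (q - p))}.
Proof.
move=> [_ [_ Z1]] sp sq a0 b1.
have -> : (fun s : R => dot (grad Z (p + s *: (q - p))) (q - p)) =
    (fun s : R => \sum_i (q - p) i 0 * pderiv Z i (p + s *: (q - p))).
  apply/funext => s; rewrite dotE; apply: eq_bigr => i _.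
  by rewrite [grad _ _ _ _]mxE mulrC.
move=> t; apply: cvg_big => [|i _]; first exact: add_continuous.
apply: cvgMl_tmp.
exact: (continuous_segment sp sq a0 b1 (Z1 i).1).
Qed.

Lemma simplex_taylor Z L2 p q : simplex_Ck 2 Z ->
  simplex_lipschitz (@spnorm R n n) L2 (hess Z) -> simplex p -> simplex q ->
  `|Z q - Z p - dot (grad Z p) (q - p)
    - dot (q - p) (hess Z p *m (q - p)) / 2| <= L2 * enorm (q - p) ^+ 3.
Proof.
move=> Z2 HL sp sq; have [Zc [Zd Z1]] := Z2.
set v := q - p; set b := dot v (hess Z p *m v).
have segI (t : R) : t \in `]0, 1[ -> simplex (p + t *: v).
  by rewrite in_itv/= => /andP[t0 t1]; apply: simplex_segment; rewrite ?ltW.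
(* With the Taylor polynomial subtracted, [h 1 - h 0] is the remainder, and the derivative of [h] at
   [s] is an increment [k s - k 0] of the function [k] below, ready for a second mean value step. *)
pose h (t : R) := Z (p + t *: v) - dot (grad Z p) v * t - b / 2 * t ^+ 2.
have [s s01 hs] : exists2 s, s \in `]0, 1[%R &
    h 1 - h 0 = (dot (grad Z (p + s *: v)) v - dot (grad Z p) v - b * s) * (1 - 0).
  apply: (@MVT _ _ (fun t => dot (grad Z (p + t *: v)) v - dot (grad Z p) v - b * t)).
  - exact: ltr01.
  - move=> t t01; have ? := is_derive_segment sp sq t01 (Zd _ (segI _ t01)).
    by apply: is_derive_eq; rewrite /GRing.scale /= -/v; field.
  - have -> : h = (fun t => Z (p + t *: v)) - *%R (dot (grad Z p) v) -
        (fun t => b / 2 * t ^+ 2) by [].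
    apply: within_continuousB; [apply: within_continuousB|].
    + exact: continuous_segment.
    + by apply: continuous_subspaceT; exact: mulrl_continuous.
    + apply: continuous_subspaceT => x; apply: cvgMl_tmp.
      exact: exprn_continuous.
have /andP[s0 s1] := s01.
pose k (t : R) := dot (grad Z (p + t *: v)) v - b * t.
have [r rs ks] : exists2 r, r \in `]0, s[%R &
    k s - k 0 = (dot v (hess Z (p + r *: v) *m v) - b) * (s - 0).
  apply: (@MVT _ _ (fun t => dot v (hess Z (p + t *: v) *m v) - b)).
  - by [].
  - move=> t; rewrite in_itv/= => /andP[t0 ts].
    have t01 : 0 < t < 1 by rewrite t0 (lt_trans ts).
    have ? := is_derive_grad_segment Z2 sp sq t01.
    by apply: is_derive_eq; rewrite /GRing.scale /= mulr1.
  - have -> : k = (fun t => dot (grad Z (p + t *: v)) v) - *%R b by [].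
    apply: within_continuousB.
      apply: continuous_grad_segment => //; last exact: ltW.
      by split=> //; split=> // i; have [] := Z1 i.
    by apply: continuous_subspaceT; exact: mulrl_continuous.
have /andP[r0 rs'] : 0 < r < s by rewrite in_itv in rs.
have sr : simplex (p + r *: v).
  by apply: segI; rewrite in_itv/= r0 (lt_trans rs').
have := HL _ _ sr sp.
rewrite addrAC subrr add0r enormZ gtr0_norm// => HLr.
have : `|dot v (hess Z (p + r *: v) *m v) - b| <= L2 * (r * enorm v) * enorm v ^+ 2.
  rewrite /b -dotNr -dotDr -mulNmx -mulmxDl (le_trans (normr_qform_le _ _))//.
  by rewrite ler_wpM2r ?sqr_ge0.
have -> : Z q - Z p - dot (grad Z p) v - b / 2 = h 1 - h 0.
  have pv : p + v = q by rewrite /v addrC subrK.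
  by rewrite /h scale1r scale0r addr0 pv; ring.
have -> : h 1 - h 0 = k s - k 0.
  by rewrite hs /k scale0r addr0; ring.
rewrite ks subr0 normrM (gtr0_norm s0) => E.
(* The sign is read off the Lipschitz inequality itself, whose left side is nonnegative. The factors
   [r] and [s] are then bounded by 1, which is why the constant is 1 and not the sharp 1/6. *)
have L0 : 0 <= L2 * enorm v.
  have := le_trans (spnorm_ge0 _) HLr.
  by rewrite mulrCA pmulr_rge0.
rewrite -[leRHS]mulr1; apply: ler_pM => //; [exact: ltW| |exact: ltW].
rewrite (le_trans E)//.
have -> : L2 * (r * enorm v) * enorm v ^+ 2 = r * (L2 * enorm v * enorm v ^+ 2) by ring.
have -> : L2 * enorm v ^+ 3 = L2 * enorm v * enorm v ^+ 2 by ring.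
rewrite ler_piMl//.
  by rewrite mulr_ge0 ?sqr_ge0.
exact/ltW/(lt_trans rs').
Qed.
End Taylor.

(** * Integrable and square-integrable real functions *)

Section SquareIntegrable.
Context {d : measure_display} {T : measurableType d} {R : realType}
  (P : probability T R).
Implicit Types f g : T -> R.

Definition in_L1 f : Prop := P.-integrable setT (EFin \o f).

(** Measurability is a separate conjunct because integrability of the square makes only the square
    measurable. *)
Definition in_L2 f : Prop :=
  measurable_fun setT f /\ in_L1 (fun x => f x ^+ 2).

Lemma Rintegral_prob_cst (a : R) : \int[P]_x a = a.
Proof.
rewrite Rintegral_cst// (_ : fine _ = 1) ?mulr1//.
by have := @probability_setT _ _ _ P; rewrite /= => ->.
Qed.

Lemma in_L1_measurable f : in_L1 f -> measurable_fun setT f.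
Proof. by move=> /measurable_int/measurable_EFinP. Qed.

Lemma in_L1D f g : in_L1 f -> in_L1 g ->
  in_L1 (fun x => f x + g x).
Proof.
move=> f1 g1; have := integrableD measurableT f1 g1.
by apply: eq_integrable => // x _.
Qed.

Lemma in_L1Zl a f : in_L1 f -> in_L1 (fun x => a * f x).
Proof.
move=> f1; have := integrableZl measurableT a f1.
by apply: eq_integrable => // x _.
Qed.

Lemma Rintegral_L1D f g : in_L1 f -> in_L1 g ->
  \int[P]_x (f x + g x) = \int[P]_x f x + \int[P]_x g x.
Proof. by move=> f1 g1; rewrite RintegralD. Qed.

Lemma Rintegral_L1Zl a f : in_L1 f -> \int[P]_x (a * f x) = a * \int[P]_x f x.
Proof. by move=> f1; rewrite RintegralZl. Qed.

Lemma in_L1_norm f : in_L1 f -> in_L1 (fun x => `|f x|).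
Proof.
move=> f1; have := integrable_norm f1.
by apply: eq_integrable => // x _.
Qed.

Lemma in_L1_sum (I : Type) (r : seq I) (F : I -> T -> R) :
  (forall i, in_L1 (F i)) -> in_L1 (fun x => \sum_(i <- r) F i x).
Proof.
move=> F1; have := integrable_sum measurableT r (fun i (_ : xpredT i) => F1 i).
by apply: eq_integrable => // x _ /=; rewrite sumEFin.
Qed.

Lemma Rintegral_sum (I : Type) (r : seq I) (F : I -> T -> R) :
  (forall i, in_L1 (F i)) ->
  \int[P]_x \sum_(i <- r) F i x = \sum_(i <- r) \int[P]_x F i x.
Proof.
move=> F1; elim: r => [|i r IH].
  rewrite big_nil; under eq_Rintegral do rewrite big_nil.
  by rewrite Rintegral_cst// mul0r.
rewrite big_cons -IH -Rintegral_L1D//; last exact: in_L1_sum.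
by apply: eq_Rintegral => x _; rewrite big_cons.
Qed.

Lemma le_in_L1 f g : measurable_fun setT f -> (forall x, `|f x| <= g x) ->
  in_L1 g -> in_L1 f.
Proof.
move=> mf fg; apply: le_integrable => //; first exact/measurable_EFinP.
by move=> x _ /=; rewrite lee_fin (le_trans (fg x))// ler_norm.
Qed.

Lemma in_L1_bounded f M : measurable_fun setT f -> (forall x, `|f x| <= M) ->
  in_L1 f.
Proof.
move=> mf fM; apply: (@le_in_L1 f (fun=> M)) => //.
exact: finite_measure_integrable_cst.
Qed.

(** Dominated through [|f g| <= f^2 + g^2]. *)
Lemma in_L2M f g : in_L2 f -> in_L2 g ->
  in_L1 (fun x => f x * g x).
Proof.
move=> [mf f2] [mg g2].
apply: le_in_L1 (in_L1D f2 g2); first exact: measurable_funM.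
by move=> x /=; rewrite ler_norml; apply/andP; split; nra.
Qed.

Lemma in_L2_bounded f M : measurable_fun setT f -> (forall x, `|f x| <= M) ->
  in_L2 f.
Proof.
move=> mf fM; split=> //; apply: (@in_L1_bounded _ (M ^+ 2)).
  exact: measurable_funX.
by move=> x; rewrite normrX ler_sqr// nnegrE ?(le_trans _ (fM x)).
Qed.

Lemma in_L2_cst a : in_L2 (fun=> a).
Proof. by apply: (@in_L2_bounded _ `|a|). Qed.

Lemma in_L2_L1 f : in_L2 f -> in_L1 f.
Proof.
move=> f2; have := in_L2M f2 (in_L2_cst 1).
by under eq_fun do rewrite mulr1.
Qed.

Lemma in_L2D f g : in_L2 f -> in_L2 g ->
  in_L2 (fun x => f x + g x).
Proof.
move=> f2 g2; split; first by apply: measurable_funD; [exact: f2.1|exact: g2.1].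
have := in_L1D (in_L1D f2.2 (in_L1Zl 2 (in_L2M f2 g2))) g2.2.
by congr in_L1; apply/funext => x; ring.
Qed.

Lemma in_L2_sum (I : Type) (r : seq I) (F : I -> T -> R) :
  (forall i, in_L2 (F i)) -> in_L2 (fun x => \sum_(i <- r) F i x).
Proof.
move=> F2; elim: r => [|i r IH].
  by under eq_fun do rewrite big_nil; exact: in_L2_cst.
by under eq_fun do rewrite big_cons; exact: in_L2D.
Qed.

Lemma in_L2_mul_bounded f g M : in_L2 f -> measurable_fun setT g ->
  (forall x, `|g x| <= M) -> in_L2 (fun x => f x * g x).
Proof.
move=> f2 mg gM; split; first exact: measurable_funM f2.1 mg.
apply: le_in_L1 (in_L1Zl (M ^+ 2) f2.2).
  by apply: measurable_funX; exact: measurable_funM f2.1 mg.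
move=> x; rewrite ger0_norm ?sqr_ge0// exprMn mulrC ler_wpM2r ?sqr_ge0//.
by rewrite -(real_normK (num_real (g x))) ler_sqr// nnegrE ?(le_trans _ (gM x)).
Qed.

Lemma expectation_Rintegral f m : ('E_P[f] = m%:E)%E -> \int[P]_x f x = m.
Proof. by rewrite unlock /Rintegral => ->. Qed.

Lemma Rintegral_expectation f : in_L1 f -> ('E_P[f] = (\int[P]_x f x)%:E)%E.
Proof. by move=> f1; rewrite unlock /Rintegral fineK// integrable_fin_num. Qed.

(** The integral is the difference of those of the positive and negative parts, and an extended-real
    difference is finite only if both terms are. *)
Lemma expectation_in_L1 f m : measurable_fun setT f ->
  ('E_P[f] = m%:E)%E -> in_L1 f.
Proof.
move=> mf; rewrite unlock integralE => fm.
have : ((\int[P]_x ((EFin \o f)^\+ x) - \int[P]_x ((EFin \o f)^\- x))%E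
  \is a fin_num) by rewrite fm.
rewrite fin_numB => /andP[fp fn].
have mEf : measurable_fun setT (EFin \o f) by exact/measurable_EFinP.
apply/integrableP; split => //.
under eq_integral do rewrite -/((abse \o (EFin \o f)) _) fune_abse.
rewrite ge0_integralD//.
- by rewrite ltey_eq fin_numD fp fn.
- exact: measurable_funepos.
- exact: measurable_funeneg.
Qed.

(** The variance bound is an inequality between extended reals, so it also yields the integrability
    of [(f - m)^2], hence of [f^2]. *)
Lemma second_moment f m s : measurable_fun setT f ->
  ('E_P[f] = m%:E)%E -> ('V_P[f] <= s%:E)%E ->
  in_L2 f /\ \int[P]_x (f x ^+ 2) <= s + m ^+ 2.
Proof.
move=> mf fm fs.
have f1 := expectation_in_L1 mf fm.
have vE : ('V_P[f] = \int[P]_x ((f x - m) ^+ 2)%:E)%E.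
  by rewrite /variance unlock fm/= unlock; apply: eq_integral => x _; rewrite expr2.
rewrite vE in fs.
have c1 : in_L1 (fun x => (f x - m) ^+ 2).
  apply/integrableP; split.
    by apply/measurable_EFinP/measurable_funX; exact: measurable_funB.
  under eq_integral do rewrite /= ger0_norm ?sqr_ge0//.
  by rewrite (le_lt_trans fs)// ltry.
have f2E x : f x ^+ 2 = (f x - m) ^+ 2 + (2 * m * f x + - m ^+ 2) by ring.
have l1 : in_L1 (fun x => 2 * m * f x + - m ^+ 2).
  apply: in_L1D; first exact: in_L1Zl.
  exact: in_L2_L1 (in_L2_cst _).
split.
  by split=> //; under eq_fun do rewrite f2E; exact: in_L1D.
under eq_Rintegral do rewrite f2E.
rewrite Rintegral_L1D// Rintegral_L1D//; last 2 first.
- exact: in_L1Zl.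
- exact: in_L2_L1 (in_L2_cst _).
rewrite Rintegral_L1Zl// (expectation_Rintegral fm) Rintegral_prob_cst.
have : \int[P]_x (f x - m) ^+ 2 <= s.
  by rewrite -lee_fin -Rintegral_expectation// unlock.
lra.
Qed.

Lemma sample_mean_moments N (Y : 'I_N -> T -> R) m : (0 < N)%N ->
  (forall j, in_L2 (Y j)) -> (forall j, \int[P]_x Y j x = m) ->
  (forall j l, j != l -> \int[P]_x (Y j x * Y l x) = m ^+ 2) ->
  [/\ in_L2 (fun x => N%:R^-1 * \sum_j Y j x),
    \int[P]_x (N%:R^-1 * \sum_j Y j x) = m &
    \int[P]_x (N%:R^-1 * \sum_j Y j x - m) ^+ 2 <=
      N%:R^-1 ^+ 2 * \sum_j \int[P]_x (Y j x ^+ 2)].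
Proof.
move=> N0 Y2 Ym Yc.
have Nn0 : N%:R != 0 :> R by rewrite pnatr_eq0 -lt0n.
pose C j x := Y j x - m.
have C2 j : in_L2 (C j) by apply: in_L2D => //; exact: in_L2_cst.
have Y1 j : in_L1 (Y j) by exact: in_L2_L1.
(* Used twice: for [j != l] the right side vanishes, and for [j = l] dropping [- m ^+ 2] leaves the
   second moment as an upper bound. *)
have CC j l : \int[P]_x (C j x * C l x) = \int[P]_x (Y j x * Y l x) - m ^+ 2.
  have -> : \int[P]_x (C j x * C l x) =
      \int[P]_x (Y j x * Y l x + (- m * Y j x + (- m * Y l x + m ^+ 2))).
    by apply: eq_Rintegral => x _; rewrite /C; ring.
  have c1 : in_L1 (fun=> m ^+ 2) by exact: in_L2_L1 (in_L2_cst _).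
  rewrite Rintegral_L1D//; last 2 first.
  - exact: in_L2M.
  - by do 2 (apply: in_L1D; first exact: in_L1Zl).
  rewrite Rintegral_L1D//; last 2 first.
  - exact: in_L1Zl.
  - by apply: in_L1D => //; exact: in_L1Zl.
  rewrite Rintegral_L1D//; last exact: in_L1Zl.
  rewrite (Rintegral_L1Zl _ (Y1 j)) (Rintegral_L1Zl _ (Y1 l)) Ym Ym Rintegral_prob_cst.
  ring.
split.
- have [Im Is] : in_L2 (fun x => \sum_j Y j x) by exact: in_L2_sum.
  split; first exact: measurable_funM.
  have := in_L1Zl (N%:R^-1 ^+ 2) Is.
  by congr in_L1; apply/funext => x; rewrite exprMn.
- rewrite Rintegral_L1Zl; last exact: in_L1_sum.
  rewrite Rintegral_sum//; under eq_bigr do rewrite Ym.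
  by rewrite sumr_const card_ord -(mulr_natl m) mulrA mulVf ?mul1r.
- have -> : \int[P]_x (N%:R^-1 * \sum_j Y j x - m) ^+ 2 =
      \int[P]_x (N%:R^-1 ^+ 2 * \sum_j \sum_l (C j x * C l x)).
    apply: eq_Rintegral => x _; rewrite -big_distrlr/= -expr2 -exprMn sumrB.
    rewrite sumr_const card_ord -(mulr_natl m); congr (_ ^+ 2).
    by rewrite mulrBr mulrA mulVf ?mul1r.
  have s1 j : in_L1 (fun x => \sum_l C j x * C l x).
    by apply: in_L1_sum => l; exact: in_L2M.
  rewrite Rintegral_L1Zl//; last exact: in_L1_sum.
  rewrite ler_wpM2l ?sqr_ge0// Rintegral_sum//; apply: ler_sum => j _.
  rewrite Rintegral_sum; last by move=> l; exact: in_L2M.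
  rewrite (bigD1 j)//= big1 ?addr0 => [|l lj]; last first.
    by rewrite CC Yc ?subrr// eq_sym.
  by rewrite CC lerBlDr lerDl sqr_ge0.
Qed.

End SquareIntegrable.

(** * Independence and Borel sets of column vectors *)

Section Independence.
Context {d : measure_display} {T : measurableType d} {R : realType}
  (P : probability T R).

(** For a fixed event [E], the sets [A] with this factorization form a Dynkin system, so a
    generating pi-system decides. *)
Lemma independent_event_generated d' (T' : measurableType d') (W : T -> T')
    (G : set (set T')) (E : set T) : measurable_fun setT W -> measurable E ->
  @measurable _ T' = <<s G >> -> setI_closed G ->
  (forall A, G A -> P (W @^-1` A `&` E) = (P (W @^-1` A) * P E)%E) ->
  forall A, measurable A -> P (W @^-1` A `&` E) = (P (W @^-1` A) * P E)%E.
Proof.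
move=> mW mE GE GI HG A; rewrite GE.
have mWA B : measurable B -> measurable (W @^-1` B).
  by move=> mB; rewrite -[_ @^-1` _]setTI; exact: mW.
move: A; apply: (@dynkin_induction _ _ G
  (fun A => P (W @^-1` A `&` E) = (P (W @^-1` A) * P E)%E)) => //.
- by rewrite preimage_setT setTI probability_setT mul1e.
- move=> S mS PS.
  have -> : W @^-1` (~` S) `&` E = E `\` (W @^-1` S `&` E).
    by rewrite preimage_setC setDIr setDv setU0 setDE setIC.
  rewrite measureD//; last 2 first.
  - by apply: measurableI => //; exact: mWA.
  - by rewrite ltey_eq fin_num_measure.
  have -> : E `&` (W @^-1` S `&` E) = W @^-1` S `&` E by rewrite setIC -setIA setIid.
  rewrite [X in (_ - X)%E]PS preimage_setC probability_setC; last exact: mWA.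
  by rewrite muleBl ?mul1e// ?fin_num_measure.
- move=> F mF tF PF.
  have tWF : trivIset setT (fun k => W @^-1` F k).
    apply/trivIsetP => i j _ _ ij; rewrite -preimage_setI.
    by move/trivIsetP : tF => /(_ i j I I ij) ->; rewrite preimage_set0.
  have tWFE : trivIset setT (fun k => W @^-1` F k `&` E).
    apply/trivIsetP => i j _ _ ij; rewrite setIACA setIid.
    by move/trivIsetP : tWF => /(_ i j I I ij) ->; rewrite set0I.
  rewrite preimage_bigcup setI_bigcupl.
  rewrite measure_bigcup//=; last by move=> k _; apply: measurableI => //; exact: mWA.
  rewrite measure_bigcup//=; last by move=> k _; exact: mWA.
  rewrite muleC -(fineK (fin_num_measure P E mE)) -nneseriesZl//.
  by apply: eq_eseriesr => k _; rewrite fineK ?fin_num_measure// muleC; exact: PF.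
Qed.

(** Rectangles form a pi-system that generates the product sigma-algebra. *)
Lemma independent_event_pair d1 d2 (T1 : measurableType d1)
    (T2 : measurableType d2) (X : T -> T1) (Y : T -> T2) (E : set T) :
  measurable_fun setT X -> measurable_fun setT Y -> measurable E ->
  (forall A B, measurable A -> measurable B ->
    P (X @^-1` A `&` Y @^-1` B `&` E) = (P (X @^-1` A `&` Y @^-1` B) * P E)%E) ->
  forall C, measurable C ->
    P ((fun t => (X t, Y t)) @^-1` C `&` E) =
    (P ((fun t => (X t, Y t)) @^-1` C) * P E)%E.
Proof.
move=> mX mY mE H; apply: (@independent_event_generated _ _ _
  [set A `*` B | A in measurable & B in measurable]) => //.
- exact: measurable_fun_pair.
- exact: measurable_prod_measurableType.
- move=> _ _ [A1 mA1 [A2 mA2 <-]] [B1 mB1 [B2 mB2 <-]].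
  exists (A1 `&` B1); first exact: measurableI.
  exists (A2 `&` B2); first exact: measurableI.
  by rewrite setXI.
- by move=> _ [A mA [B mB <-]]; exact: H.
Qed.

Definition independent2 d1 d2 (T1 : measurableType d1) (T2 : measurableType d2)
    (X : T -> T1) (Y : T -> T2) :=
  forall A B, measurable A -> measurable B ->
    P (X @^-1` A `&` Y @^-1` B) = (P (X @^-1` A) * P (Y @^-1` B))%E.

Section Decoupling.
Context d1 d2 (T1 : measurableType d1) (T2 : measurableType d2).
Variables (X : T -> T1) (Y : T -> T2).
Hypotheses (mX : measurable_fun setT X) (mY : measurable_fun setT Y).
Hypothesis XY : independent2 X Y.

Let XandY t := (X t, Y t).

Let mXY : measurable_fun setT XandY.
Proof. exact: measurable_fun_pair. Qed.

HB.instance Definition _ := isMeasurableFun.Build _ _ _ _ X mX.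
HB.instance Definition _ := isMeasurableFun.Build _ _ _ _ Y mY.
HB.instance Definition _ := isMeasurableFun.Build _ _ _ _ XandY mXY.

Let PX : probability T1 R := distribution P X.
Let PY : probability T2 R := distribution P Y.
Let PXY : probability (T1 * T2)%type R := distribution P XandY.

(** Independence says that the two measures agree on rectangles, and these determine the product
    measure. *)
Let joint_law A : measurable A -> (PX \x PY)%E A = PXY A.
Proof.
apply: product_measure_unique => A1 A2 mA1 mA2; exact: XY.
Qed.

Lemma measurable_integral_decoupled (f : T1 * T2 -> \bar R) :
  measurable_fun setT f -> (forall z, (0 <= f z)%E) ->
  measurable_fun setT (fun t => \int[P]_s f (X t, Y s))%E.
Proof.
move=> mf f0.
apply: (eq_measurable_fun (fubini_F PY f \o X)).
  move=> t _; rewrite /= /fubini_F ge0_integral_distribution//.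
  exact: measurable_fun_pair2.
by apply: measurableT_comp => //; exact: measurable_fun_fubini_tonelli_F.
Qed.

(** Pushing forward to the product law, Tonelli's theorem applies, and each marginal integral is
    then pulled back to [T]. The second variable [s] acts as an independent copy, so [X t] is frozen
    in the inner integral. *)
Lemma ge0_decoupling (f : T1 * T2 -> \bar R) :
  measurable_fun setT f -> (forall x, (0 <= f x)%E) ->
  (\int[P]_t f (X t, Y t) = \int[P]_t \int[P]_s f (X t, Y s))%E.
Proof.
move=> mf f0.
have -> : (\int[P]_t f (X t, Y t) = \int[PXY]_z f z)%E.
  by rewrite ge0_integral_distribution.
rewrite -(eq_measure_integral PXY (fun A mA _ => joint_law mA)).
rewrite fubini_tonelli1// ge0_integral_distribution//; last 2 first.
- exact: measurable_fun_fubini_tonelli_F.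
- by move=> x; apply: integral_ge0 => y _.
apply: eq_integral => t _; rewrite /= /fubini_F ge0_integral_distribution//.
exact: measurable_fun_pair2.
Qed.

Let ge0_Rintegral_decoupling (f : T1 * T2 -> R) : measurable_fun setT f ->
  (forall z, 0 <= f z) -> in_L1 P (fun t => f (X t, Y t)) ->
  (forall t, in_L1 P (fun s => f (X t, Y s))) ->
  in_L1 P (fun t => \int[P]_s f (X t, Y s)) /\
  \int[P]_t f (X t, Y t) = \int[P]_t \int[P]_s f (X t, Y s).
Proof.
move=> mf f0 f1 f2.
have mEf : measurable_fun setT (EFin \o f) by exact/measurable_EFinP.
have fE t : ((\int[P]_s f (X t, Y s))%:E = \int[P]_s (f (X t, Y s))%:E)%E.
  by rewrite /Rintegral fineK// integrable_fin_num//; exact: f2.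
have DE := ge0_decoupling mEf (fun z => f0 z).
split; last first.
  by rewrite /Rintegral DE; congr fine; apply: eq_integral => t _; rewrite fE.
apply/integrableP; split.
  have := measurable_integral_decoupled mEf (fun z => f0 z).
  by congr measurable_fun; apply/funext => t; rewrite /= fE.
have -> : (\int[P]_t `|(EFin \o (fun t => \int[P]_s f (X t, Y s))%R) t| =
    \int[P]_t (f (X t, Y t))%:E)%E.
  rewrite DE; apply: eq_integral => t _.
  by rewrite -fE /= ger0_norm// Rintegral_ge0.
by rewrite ltey_eq integrable_fin_num.
Qed.

Lemma Rintegral_decoupling (f : T1 * T2 -> R) : measurable_fun setT f ->
  in_L1 P (fun t => f (X t, Y t)) ->
  (forall t, in_L1 P (fun s => f (X t, Y s))) ->
  \int[P]_t f (X t, Y t) = \int[P]_t \int[P]_s f (X t, Y s).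
Proof.
move=> mf f1 f2.
(* The cases [a = 1] and [a = -1] are the positive and negative parts of [f]. *)
pose g a z := Num.max (a * f z) 0.
have mg a : measurable_fun setT (g a).
  by apply: measurable_maxr => //; exact: measurable_funM.
have g0 a z : 0 <= g a z by rewrite /g le_max lexx orbT.
have gs a (h : T -> T1 * T2) : measurable_fun setT h ->
    in_L1 P (f \o h) -> in_L1 P (g a \o h).
  move=> mh fh1; apply: le_in_L1 (in_L1Zl `|a| (in_L1_norm fh1)).
    exact: measurableT_comp.
  move=> t /=; rewrite ger0_norm// /g -normrM.
  by rewrite ge_max normr_ge0 ler_norm.
have fE z : f z = g 1 z + -1 * g (-1) z.
  rewrite /g mul1r !mulN1r; case: (leP (f z) 0) => fz.
    by rewrite max_l ?oppr_ge0// add0r opprK.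
  by rewrite max_r ?subr0// oppr_le0 ltW.
have mp t : measurable_fun setT (fun s => (X t, Y s)).
  by apply: measurable_fun_pair.
have [p1 pE] := ge0_Rintegral_decoupling (mg 1) (g0 1) (gs 1 _ mXY f1)
  (fun t => gs 1 _ (mp t) (f2 t)).
have [n1 nE] := ge0_Rintegral_decoupling (mg (-1)) (g0 (-1)) (gs (-1) _ mXY f1)
  (fun t => gs (-1) _ (mp t) (f2 t)).
have -> : \int[P]_t f (X t, Y t) = \int[P]_t (g 1 (X t, Y t) + -1 * g (-1) (X t, Y t)).
  by apply: eq_Rintegral => t _; exact: fE.
rewrite Rintegral_L1D; last 2 first.
- exact: gs mXY f1.
- apply: in_L1Zl; exact: gs mXY f1.
rewrite Rintegral_L1Zl; last exact: gs mXY f1.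
rewrite pE nE -Rintegral_L1Zl// -Rintegral_L1D//; last exact: in_L1Zl.
apply: eq_Rintegral => t _.
rewrite -Rintegral_L1Zl; last exact: gs (mp t) (f2 t).
rewrite -Rintegral_L1D; last 2 first.
- exact: gs (mp t) (f2 t).
- apply: in_L1Zl; exact: gs (mp t) (f2 t).
by apply: eq_Rintegral => s _; rewrite -fE.
Qed.

End Decoupling.

Lemma Rintegral_mul_independent (U V : T -> R) : independent2 U V ->
  in_L1 P U -> in_L1 P V -> in_L1 P (fun t => U t * V t) ->
  \int[P]_t (U t * V t) = (\int[P]_t U t) * (\int[P]_t V t).
Proof.
move=> UV U1 V1 UV1.
have := Rintegral_decoupling (in_L1_measurable U1) (in_L1_measurable V1)
  UV (f := fun z => z.1 * z.2) _ UV1.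
move=> /= ->; last 2 first.
- by apply: measurable_funM.
- by move=> t; exact: in_L1Zl.
under eq_Rintegral do rewrite Rintegral_L1Zl//.
rewrite mulrC -Rintegral_L1Zl//.
by apply: eq_Rintegral => t _; rewrite mulrC.
Qed.
End Independence.

(** * From mutual independence of single elements to independence of pairs *)

Section MutualIndependence.
Context {d : measure_display} {T : measurableType d} {R : realType}
  (P : probability T R).

(** An explicit list of indices turns the intersection and the product into iterated operations that
    unfold. *)
Lemma mutually_independent_seq (I : finType) (G : I -> set (set T))
    (s : seq I) (A : I -> set T) : mutually_independent P G -> uniq s ->
  (forall i, i \in s -> G i (A i)) ->
  P (\big[setI/setT]_(i <- s) A i) = (\prod_(i <- s) P (A i))%E.
Proof.
move=> PG us GA.
rewrite -bigcap_seq big_uniq//=.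
have := PG [set i in s] A; rewrite (eq_bigl (mem s)); last by move=> i; rewrite inE.
move=> <-; last by move=> i; rewrite inE; exact: GA.
by congr (P (\bigcap_(i in _) A i)); apply/seteqP; split => i /=; rewrite inE.
Qed.

Lemma independent2_comp d1 d2 d3 d4 (T1 : measurableType d1)
    (T2 : measurableType d2) (T3 : measurableType d3) (T4 : measurableType d4)
    (X : T -> T1) (Y : T -> T2) (f : T1 -> T3) (g : T2 -> T4) :
  independent2 P X Y -> measurable_fun setT f -> measurable_fun setT g ->
  independent2 P (f \o X) (g \o Y).
Proof.
move=> XY mf mg A B mA mB.
by apply: (XY (f @^-1` A) (g @^-1` B)); rewrite -[_ @^-1` _]setTI; [exact: mf|exact: mg].
Qed.

Context (N : nat) d1 d2 (T1 : measurableType d1) (T2 : measurableType d2).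
Variables (U : 'I_N -> T -> T1) (V : 'I_N -> T -> T2).
Hypotheses (mU : forall j, measurable_fun setT (U j))
  (mV : forall j, measurable_fun setT (V j)).
Hypothesis UV : mutually_independent P (fun s : 'I_N + 'I_N =>
  match s with inl j => sigma_of (U j) | inr j => sigma_of (V j) end).

Let mUA j A : measurable A -> measurable (U j @^-1` A).
Proof. by move=> mA; rewrite -[_ @^-1` _]setTI; exact: mU. Qed.

Let mVA j A : measurable A -> measurable (V j @^-1` A).
Proof. by move=> mA; rewrite -[_ @^-1` _]setTI; exact: mV. Qed.

Let sU j A : measurable A -> sigma_of (U j) (U j @^-1` A).
Proof. by move=> mA; exists A => //; rewrite setTI. Qed.

Let sV j A : measurable A -> sigma_of (V j) (V j @^-1` A).
Proof. by move=> mA; exists A => //; rewrite setTI. Qed.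

Lemma mutually_independent_diag j : independent2 P (U j) (V j).
Proof.
move=> A B mA mB.
pose S (s : 'I_N + 'I_N) :=
  match s with inl i => U i @^-1` A | inr i => V i @^-1` B end.
have := mutually_independent_seq (s := [:: inl j; inr j]) (A := S) UV.
rewrite !big_cons !big_nil setIT mule1; apply => //.
by move=> [i|i] _; [exact: sU|exact: sV].
Qed.

(** The pi-system argument is used twice: with the event of pair [l] fixed it reduces [C] to
    rectangles, and with such a rectangle fixed it reduces [D]. What remains is a product formula
    for four events. *)
Lemma mutually_independent_pairs j l : j != l ->
  independent2 P (fun t => (U j t, V j t)) (fun t => (U l t, V l t)).
Proof.
move=> jl C D mC mD.
have mUV i : measurable_fun setT (fun t => (U i t, V i t)).
  exact: measurable_fun_pair.
apply: independent_event_pair => //.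
  by rewrite -[_ @^-1` _]setTI; exact: mUV.
move=> A B mA mB; rewrite setIC [RHS]muleC; apply: independent_event_pair => //.
  by apply: measurableI; [exact: mUA|exact: mVA].
move=> A' B' mA' mB'.
(* A family on all indices is required; only its values at [j] and [l] matter. *)
pose S (s : 'I_N + 'I_N) := match s with
  | inl i => if i == j then U i @^-1` A else U i @^-1` A'
  | inr i => if i == j then V i @^-1` B else V i @^-1` B' end.
have SP (i : 'I_N + 'I_N) : match i with
  | inl j => sigma_of (U j) | inr j => sigma_of (V j) end (S i).
  by case: i => i /=; case: ifP => _; [exact: sU|exact: sU|exact: sV|exact: sV].
have Uj := mutually_independent_diag j mA mB.
have Ul := mutually_independent_diag l mA' mB'.
have := mutually_independent_seq (s := [:: inl l; inr l; inl j; inr j]) (A := S) UV.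
rewrite !big_cons !big_nil setIT mule1 /S eqxx eq_sym (negPf jl).
rewrite Uj Ul setIA => ->//; first by rewrite muleA.
- have lj : (l == j) = false by rewrite eq_sym (negPf jl).
  by rewrite /= !inE /eq_op/= lj.
- by move=> i _; exact: SP.
Qed.

End MutualIndependence.

(** * Borel measurability on column vectors and of the simplex *)

Section Borel.
Context {R : realType} {n : nat}.

Lemma continuous_measurable_borel_cV (f : 'cV[R]_n -> 'cV[R]_n) : continuous f ->
  measurable_fun setT (f : borel_cV R n -> borel_cV R n).
Proof.
move=> /continuousP cf.
apply: (@measurability _ _ (borel_cV R n) (borel_cV R n) _ _ (@open 'cV[R]_n)) => //.
move=> _ [A oA <-]; rewrite setTI; apply: sub_sigma_algebra; exact: cf.
Qed.

Lemma subspace_continuous_measurable_cV (D : set 'cV[R]_n) (f : 'cV[R]_n -> R) :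
  measurable (D : set (borel_cV R n)) -> {within D, continuous f} ->
  measurable_fun (D : set (borel_cV R n)) f.
Proof.
move=> mD /continuousP cf; apply: (measurability _ (RGenOpens.measurableE R)).
move=> _ [_ [a [b ->] <-]].
have oab : open (`]a, b[%classic : set R) by exact: interval_open.
have /open_subspaceP [V oV VD] := cf _ oab.
rewrite setIC -VD; apply: measurableI => //; exact: sub_sigma_algebra.
Qed.

Lemma continuous_measurable_cV (f : 'cV[R]_n -> R) : continuous f ->
  measurable_fun setT (f : borel_cV R n -> R).
Proof.
move=> cf; apply: subspace_continuous_measurable_cV => //.
exact: continuous_subspaceT.
Qed.

Lemma measurable_coord i : measurable_fun setT (fun x : borel_cV R n => (x : 'cV[R]_n) i 0).
Proof. by apply: continuous_measurable_cV; exact: coord_continuous. Qed.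

Lemma measurable_simplex : measurable (simplex : set (borel_cV R n)).
Proof.
have -> : (simplex : set (borel_cV R n)) =
    (fun x : borel_cV R n => \sum_i (x : 'cV[R]_n) i 0) @^-1` [set 1] `&`
    \bigcap_(i in [set: 'I_n])
      (fun x : borel_cV R n => (x : 'cV[R]_n) i 0) @^-1` `[0, +oo[.
  apply/seteqP; split => x.
    move=> sx; split; first exact: simplex_sum.
    by move=> i _ /=; rewrite in_itv/= andbT; exact: sx.2.
  move=> [x1 x0]; split.
    by rewrite dotE -[RHS]x1; apply: eq_bigr => i _; rewrite mxE mul1r.
  by move=> i; have := x0 i I; rewrite /= in_itv/= andbT.
have mS : measurable_fun setT
    (fun x : borel_cV R n => \sum_i (x : 'cV[R]_n) i 0).
  by apply: measurable_sum => i; exact: measurable_coord.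
apply: measurableI.
  rewrite -[_ @^-1` _]setTI; apply: mS => //.
apply: fin_bigcap_measurable => // i _.
rewrite -[_ @^-1` _]setTI; exact: measurable_coord.
Qed.

End Borel.

(** * The bias of the estimator *)

Section BoundedMeasurable.
Context {d : measure_display} {T : measurableType d} {R : realType}.
Implicit Types f g : T -> R.

(** Unlike [in_L1], this class is stable under products. The integrands of the bias are built from
    the bounded coordinates of [delta - p] and bounded values of [Z], so their integrability follows
    from their shape. *)
Definition bounded_measurable f : Prop :=
  measurable_fun setT f /\ exists M, forall x, `|f x| <= M.

Lemma bounded_measurable_cst a : bounded_measurable (fun=> a).
Proof. by split=> //; exists `|a|. Qed.

Lemma bounded_measurableD f g : bounded_measurable f -> bounded_measurable g ->
  bounded_measurable (fun x => f x + g x).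
Proof.
move=> [mf [M fM]] [mg [M' gM']]; split; first exact: measurable_funD.
by exists (M + M') => x; rewrite (le_trans (ler_normD _ _))// lerD.
Qed.

Lemma bounded_measurableM f g : bounded_measurable f -> bounded_measurable g ->
  bounded_measurable (fun x => f x * g x).
Proof.
move=> [mf [M fM]] [mg [M' gM']]; split; first exact: measurable_funM.
by exists (M * M') => x; rewrite normrM ler_pM.
Qed.

Lemma bounded_measurableB f g : bounded_measurable f -> bounded_measurable g ->
  bounded_measurable (fun x => f x - g x).
Proof.
move=> bf bg; have := bounded_measurableD bf (bounded_measurableM (bounded_measurable_cst (-1)) bg).
by congr bounded_measurable; apply/funext => x; rewrite mulN1r.
Qed.

Lemma bounded_measurable_sum (I : Type) (r : seq I) (F : I -> T -> R) :
  (forall i, bounded_measurable (F i)) ->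
  bounded_measurable (fun x => \sum_(i <- r) F i x).
Proof.
move=> bF; elim: r => [|i r IH].
  by under eq_fun do rewrite big_nil; exact: bounded_measurable_cst.
by under eq_fun do rewrite big_cons; exact: bounded_measurableD.
Qed.

Lemma bounded_measurable_in_L1 (P : probability T R) f :
  bounded_measurable f -> in_L1 P f.
Proof. by move=> [mf [M fM]]; exact: in_L1_bounded fM. Qed.

End BoundedMeasurable.

Section Bias.
Context {R : realType} {n : nat} {d : measure_display} {T : measurableType d}
  (P : probability T R).
Variables (delta : T -> 'cV[R]_n) (p : 'cV[R]_n) (gamma lambda : R).
Hypothesis n1 : (1 < n)%N.
Hypothesis mdelta : measurable_fun setT (delta : T -> borel_cV R n).
Hypothesis sp : simplex p.
Hypothesis sdelta : forall t, simplex (delta t).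
Hypothesis MC1 : has_mean P (fun t => score gamma p (delta t)) 0.
Hypothesis MC2 : has_mean P
  (fun t => (delta t - p) *m (score gamma p (delta t))^T)
  (1%:M - lambda *: (ones n *m (ones n)^T)).

Let D t := delta t - p.

Let bmD i : bounded_measurable (fun t => D t i 0).
Proof.
split.
  have -> : (fun t => D t i 0) =
     (fun x : borel_cV R n => (x : 'cV[R]_n) i 0) \o delta \- cst (p i 0).
    by apply/funext => t; rewrite /D !mxE.
  apply: measurable_funB => //; apply: measurableT_comp => //.
  exact: measurable_coord.
exists 1 => t; rewrite !mxE ler_norml.
have := (sdelta t).2 i; have := simplex_le1 i (sdelta t).
have := sp.2 i; have := simplex_le1 i sp; lra.
Qed.

Let bm_dot v : bounded_measurable (fun t => dot (D t) v).
Proof.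
under eq_fun do rewrite dotE; apply: bounded_measurable_sum => i.
exact: bounded_measurableM (bmD i) (bounded_measurable_cst _).
Qed.

Let bm1 f : bounded_measurable f -> in_L1 P f.
Proof. exact: bounded_measurable_in_L1. Qed.

Let sumD t : \sum_i D t i 0 = 0.
Proof. exact: simplex_sumB. Qed.

Let normD t : enorm (D t) ^+ 2 <= 2.
Proof. exact: sqr_enorm_simplexB. Qed.

Let meanD v : \int[P]_t (gamma * dot (D t) v) = 0.
Proof.
under eq_Rintegral do rewrite dotE mulr_sumr.
rewrite Rintegral_sum; last first.
  move=> i; apply: bm1; apply: bounded_measurableM (bounded_measurable_cst _) _.
  exact: bounded_measurableM (bmD i) (bounded_measurable_cst _).
apply: big1 => i _.
have := expectation_Rintegral (MC1 i 0); rewrite mxE => mi.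
transitivity (\int[P]_t (v i 0 * score gamma p (delta t) i 0)).
  by apply: eq_Rintegral => t _; rewrite /score /D !mxE; ring.
rewrite Rintegral_L1Zl ?mi ?mulr0//; apply: bm1.
have := bounded_measurableM (bounded_measurable_cst gamma) (bmD i).
by congr bounded_measurable; apply/funext => t; rewrite /score /D !mxE.
Qed.

Let mean2 i k : \int[P]_t (gamma * (D t i 0 * D t k 0)) = (i == k)%:R - lambda.
Proof.
have := expectation_Rintegral (MC2 i k); rewrite !mxE.
rewrite big_ord1 !mxE !mulr1 => <-; apply: eq_Rintegral => t _.
by rewrite [in RHS]mxE big_ord1 /D /score !mxE; ring.
Qed.

Let bmDD i k : bounded_measurable (fun t => gamma * (D t i 0 * D t k 0)).
Proof.
by apply: bounded_measurableM (bounded_measurable_cst _) _; exact: bounded_measurableM.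
Qed.

Let n0 : n%:R != 0 :> R.
Proof. by rewrite pnatr_eq0 -lt0n ltnW. Qed.

Let lambdaE : lambda = n%:R^-1.
Proof.
pose i : 'I_n := Ordinal n1.
have : \int[P]_t (\sum_k gamma * (D t i 0 * D t k 0)) = 0.
  rewrite -[RHS](Rintegral_prob_cst P 0); apply: eq_Rintegral => t _.
  by rewrite -mulr_sumr -mulr_sumr sumD !mulr0.
rewrite Rintegral_sum; last by move=> k; exact: bm1.
under eq_bigr do rewrite mean2.
rewrite sumrB sumr_const card_ord (bigD1 i)//= ?eqxx big1; last first.
  by move=> k ki; rewrite eq_sym (negPf ki).
rewrite addr0 -(mulr_natl lambda) => /eqP; rewrite subr_eq0 => /eqP nl.
by apply: (mulfI n0); rewrite -nl mulfV.
Qed.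

Let mean_norm : gamma * \int[P]_t (enorm (D t) ^+ 2) = n%:R - 1.
Proof.
transitivity (\int[P]_t (\sum_i gamma * (D t i 0 * D t i 0))).
  rewrite -Rintegral_L1Zl.
    by apply: eq_Rintegral => t _; rewrite sqr_enorm dotE mulr_sumr.
  apply: bm1; under eq_fun do rewrite sqr_enorm dotE.
  by apply: bounded_measurable_sum => i; exact: bounded_measurableM.
rewrite Rintegral_sum; last by move=> i; exact: bm1.
under eq_bigr do rewrite mean2 eqxx.
by rewrite sumr_const card_ord lambdaE mulrnBl -(mulr_natl n%:R^-1) mulfV.
Qed.

Lemma gamma_gt0 : 0 < gamma.
Proof.
have I0 : 0 <= \int[P]_t (enorm (D t) ^+ 2).
  by apply: Rintegral_ge0 => t _; exact: sqr_ge0.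
have gI : 0 < gamma * \int[P]_t (enorm (D t) ^+ 2).
  by rewrite mean_norm subr_gt0 ltr1n.
rewrite -(pmulr_lgt0 _ (_ : 0 < \int[P]_t (enorm (D t) ^+ 2)))//.
rewrite lt_neqAle I0 andbT; apply/negP => /eqP I00.
by move: gI; rewrite -I00 mulr0 ltxx.
Qed.

Lemma mean_sqr_enorm : gamma * \int[P]_t (enorm (delta t - p) ^+ 2) = n%:R - 1.
Proof. exact: mean_norm. Qed.

(** (MC2) contracted with [g] and [v]; its rank-one part is what [epsilon_0] compensates. *)
Let mean_dot g v : \int[P]_t (gamma * (dot (D t) g * dot (D t) v)) =
  dot g v - dot g (ones n) * dot (ones n) v / n%:R.
Proof.
transitivity (\int[P]_t (\sum_i \sum_k g i 0 * v k 0 * (gamma * (D t i 0 * D t k 0)))).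
  apply: eq_Rintegral => t _; rewrite !dotE big_distrlr/= mulr_sumr.
  apply: eq_bigr => i _; rewrite mulr_sumr; apply: eq_bigr => k _; ring.
rewrite Rintegral_sum; last first.
  by move=> i; apply: in_L1_sum => k; apply: in_L1Zl; exact: bm1.
transitivity (\sum_i (g i 0 * v i 0 - \sum_k (g i 0 * v k 0 / n%:R))).
  apply: eq_bigr => i _; rewrite Rintegral_sum; last first.
    by move=> k; apply: in_L1Zl; exact: bm1.
  transitivity (\sum_k (g i 0 * v k 0 * (i == k)%:R - g i 0 * v k 0 / n%:R)).
    apply: eq_bigr => k _; rewrite Rintegral_L1Zl ?mean2 ?lambdaE ?mulrBr//.
    exact: bm1.
  rewrite sumrB; congr (_ - _); rewrite (bigD1 i)//= eqxx mulr1 big1 ?addr0//.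
  by move=> k ki; rewrite eq_sym (negPf ki) mulr0.
rewrite sumrB dotE; congr (_ - _); rewrite !dotE big_distrlr/= mulr_suml.
apply: eq_bigr => i _; rewrite mulr_suml; apply: eq_bigr => k _.
by rewrite !mxE mulr1 mul1r.
Qed.

Variables (Z : 'cV[R]_n -> R) (c L2 : R) (psi : 'cV[R]_n).
Hypothesis Z2 : simplex_Ck 2 Z.
Hypothesis ZL2 : simplex_lipschitz (@spnorm R n n) L2 (hess Z).
Hypothesis c01 : 0 < c <= 1.
Hypothesis bmZ : bounded_measurable (fun t => Z ((1 - c) *: p + c *: delta t)).
Hypothesis psiE : forall k, psi k 0 = \int[P]_t
  (Z ((1 - c) *: p + c *: delta t) / c * score gamma p (delta t) k 0).

Let H := hess Z p.
Let rem t := Z ((1 - c) *: p + c *: delta t) - Z p - c * dot (D t) (grad Z p)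
  - c ^+ 2 / 2 * dot (D t) (H *m D t).

Let c_gt0 : 0 < c. Proof. by case/andP: c01. Qed.

Let bmH : bounded_measurable (fun t => dot (D t) (H *m D t)).
Proof.
under eq_fun do rewrite dotE; apply: bounded_measurable_sum => i.
apply: bounded_measurableM => //; under eq_fun do rewrite mxE.
apply: bounded_measurable_sum => j.
exact: bounded_measurableM (bounded_measurable_cst _) (bmD j).
Qed.

Let bm_scale (a : R) (f : T -> R) : bounded_measurable f -> bounded_measurable (fun t : T => a * f t).
Proof. exact: bounded_measurableM (bounded_measurable_cst a). Qed.

Let bm_rem : bounded_measurable rem.
Proof.
apply: bounded_measurableB; last exact: bm_scale.
apply: bounded_measurableB; last exact: bm_scale.
by apply: bounded_measurableB => //; exact: bounded_measurable_cst.
Qed.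

Let bm_quad v : bounded_measurable (fun t => dot (D t) (H *m D t) * (gamma * dot (D t) v)).
Proof. by apply: bounded_measurableM => //; exact: bm_scale. Qed.

Let bm_remv v : bounded_measurable (fun t => rem t / c * (gamma * dot (D t) v)).
Proof.
apply: bounded_measurableM; last exact: bm_scale.
by apply: bounded_measurableM => //; exact: bounded_measurable_cst.
Qed.

(** An exact identity behind both bias bounds: in general both integrals are estimated, while under
    (MC3) the second is computed. *)
Lemma dot_biasE v :
  dot (psi - grad Z p - - (dot (grad Z p) (ones n) / n%:R) *: ones n) v =
  \int[P]_t (rem t / c * (gamma * dot (D t) v)) +
  c / 2 * \int[P]_t (dot (D t) (H *m D t) * (gamma * dot (D t) v)).
Proof.
set g := grad Z p.
have psiv : dot psi v = \int[P]_t (rem t / c * (gamma * dot (D t) v) +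
    (c / 2 * (dot (D t) (H *m D t) * (gamma * dot (D t) v)) +
     (Z p / c * (gamma * dot (D t) v) + gamma * (dot (D t) g * dot (D t) v)))).
  transitivity (\int[P]_t (\sum_k v k 0 *
      (Z ((1 - c) *: p + c *: delta t) / c * score gamma p (delta t) k 0))).
    rewrite Rintegral_sum => [|k].
      rewrite dotE; apply: eq_bigr => k _; rewrite psiE mulrC Rintegral_L1Zl//.
      apply: bm1; apply: bounded_measurableM.
        by apply: bounded_measurableM => //; exact: bounded_measurable_cst.
      have := bm_scale gamma (bmD k).
      by congr bounded_measurable; apply/funext => t; rewrite /score /D !mxE.
    apply: in_L1Zl; apply: bm1; apply: bounded_measurableM.
      by apply: bounded_measurableM => //; exact: bounded_measurable_cst.
    have := bm_scale gamma (bmD k).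
    by congr bounded_measurable; apply/funext => t; rewrite /score /D !mxE.
  apply: eq_Rintegral => t _.
  transitivity (Z ((1 - c) *: p + c *: delta t) / c * (gamma * dot (D t) v)).
    rewrite dotE mulr_sumr mulr_sumr; apply: eq_bigr => k _.
    by rewrite /score /D !mxE; ring.
  (* The definition of [rem], solved for [Z] at the shifted point and divided by [c]. *)
  by rewrite /rem; field; rewrite gt_eqF.
rewrite !(dotDl, dotNl, dotZl) psiv.
have s1 := bm1 (bm_remv v).
have s2 : in_L1 P (fun t => c / 2 * (dot (D t) (H *m D t) * (gamma * dot (D t) v))).
  by apply: bm1; apply: bm_scale.
have s3 : in_L1 P (fun t => Z p / c * (gamma * dot (D t) v)).
  by apply: bm1; do 2 apply: bm_scale.
have s4 : in_L1 P (fun t => gamma * (dot (D t) g * dot (D t) v)).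
  by apply: bm1; apply: bm_scale; exact: bounded_measurableM.
rewrite Rintegral_L1D//; last by apply: in_L1D => //; exact: in_L1D.
rewrite Rintegral_L1D//; last exact: in_L1D.
rewrite Rintegral_L1D// mean_dot.
rewrite Rintegral_L1Zl; last by apply: bm1.
rewrite Rintegral_L1Zl; last by apply: bm1; exact: bm_scale.
by rewrite meanD mulr0; field.
Qed.

Let normDE t : enorm (c *: D t) = c * enorm (D t).
Proof. by rewrite enormZ gtr0_norm. Qed.

Let rem_le t : `|rem t| <= L2 * (c * enorm (D t)) ^+ 3.
Proof.
have qE : (1 - c) *: p + c *: delta t = p + c *: D t.
  by rewrite /D scalerBl scale1r scalerBr addrA addrAC.
have sq : simplex (p + c *: D t).
  by apply: simplex_segment => //; case/andP: c01 => /ltW -> ->.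
have := simplex_taylor Z2 ZL2 sp sq.
have -> : p + c *: D t - p = c *: D t by rewrite addrC addKr.
rewrite normDE -scalemxAr !(dotZl, dotZr) (dotC (grad Z p)).
by congr (`|_| <= _); rewrite /rem /H qE; ring.
Qed.

Let L2_ge0 : 0 <= L2.
Proof. by apply: simplex_lipschitz_ge0 ZL2 => // x; exact: spnorm_ge0. Qed.

Let ptD t v : `|gamma * dot (D t) v| <= gamma * enorm (D t) * enorm v.
Proof.
by rewrite normrM (gtr0_norm gamma_gt0) -mulrA ler_pM2l ?gamma_gt0// normr_dot_le.
Qed.

(** The origin of the factor [n]: a pointwise bound that keeps [gamma] and exactly two powers of
    [|D|] integrates to [n - 1] times the rest. *)
Let int_norm_le (f : T -> R) (a : R) (v : 'cV[R]_n) : bounded_measurable f -> 0 <= a ->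
  (forall t, f t <= gamma * a * enorm v * enorm (D t) ^+ 2) ->
  \int[P]_t f t <= n%:R * a * enorm v.
Proof.
move=> bf a0 fle.
have bn : bounded_measurable (fun t => enorm (D t) ^+ 2).
  under eq_fun do rewrite sqr_enorm dotE.
  by apply: bounded_measurable_sum => i; exact: bounded_measurableM.
apply: (@le_trans _ _ (\int[P]_t (gamma * a * enorm v * enorm (D t) ^+ 2))).
  apply: le_Rintegral => //; first exact: bm1.
  by apply: bm1; exact: bm_scale.
rewrite Rintegral_L1Zl; last exact: bm1.
have -> : gamma * a * enorm v * \int[P]_x enorm (D x) ^+ 2 =
    a * enorm v * (gamma * \int[P]_x enorm (D x) ^+ 2) by ring.
rewrite mean_norm [leRHS](_ : _ = a * enorm v * n%:R); last by ring.
by rewrite ler_wpM2l ?mulr_ge0 ?enorm_ge0// lerBlDr lerDl.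
Qed.

Let int_rem_le v : \int[P]_t (rem t / c * (gamma * dot (D t) v)) <=
  n%:R * (2 * (c ^+ 2 * L2)) * enorm v.
Proof.
apply: int_norm_le => [||t]; first exact: bm_remv.
  exact: mulr_ge0 (ler0n _ 2) (mulr_ge0 (sqr_ge0 c) L2_ge0).
rewrite (le_trans (ler_norm _))// normrM normrM normfV (gtr0_norm c_gt0).
have step : `|rem t| / c * `|gamma * dot (D t) v| <=
    L2 * (c * enorm (D t)) ^+ 3 / c * (gamma * enorm (D t) * enorm v).
  apply: ler_pM => //; first by rewrite divr_ge0// ltW.
  by rewrite ler_pM2r ?invr_gt0.
rewrite (le_trans step)//.
(* Three powers of [|D|] from the remainder and one from the score: one square is integrated, the
   other is at most 2. *)
have -> : L2 * (c * enorm (D t)) ^+ 3 / c * (gamma * enorm (D t) * enorm v) =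
    gamma * (c ^+ 2 * L2) * enorm v * enorm (D t) ^+ 2 * enorm (D t) ^+ 2.
  by field; rewrite gt_eqF.
have -> : gamma * (2 * (c ^+ 2 * L2)) * enorm v * enorm (D t) ^+ 2 =
  gamma * (c ^+ 2 * L2) * enorm v * enorm (D t) ^+ 2 * 2 by ring.
rewrite ler_wpM2l//.
by rewrite !mulr_ge0 ?sqr_ge0 ?enorm_ge0// ltW ?gamma_gt0.
Qed.

Let int_quad_le v : c / 2 * \int[P]_t (dot (D t) (H *m D t) * (gamma * dot (D t) v)) <=
  n%:R * (2 * (c * spnorm H)) * enorm v.
Proof.
rewrite -Rintegral_L1Zl; last exact: bm1.
apply: int_norm_le => [||t]; first exact: bm_scale.
  by rewrite !mulr_ge0// ?spnorm_ge0// ltW.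
have c2 : 0 < c / 2 by rewrite divr_gt0.
rewrite (le_trans (ler_norm _))// normrM (gtr0_norm c2) normrM.
have step : `|dot (D t) (H *m D t)| * `|gamma * dot (D t) v| <=
    spnorm H * enorm (D t) ^+ 2 * (gamma * enorm (D t) * enorm v).
  by apply: ler_pM => //; exact: normr_qform_le.
(* Here three powers of [|D|] occur, so one is left over beside the integrated square. The crude
   bound 2 is enough for the constant already needed for the remainder. *)
have D2 : enorm (D t) <= 2 by have := normD t; have := enorm_ge0 (D t); nra.
rewrite (le_trans (ler_wpM2l (ltW c2) step))//.
have -> : c / 2 * (spnorm H * enorm (D t) ^+ 2 * (gamma * enorm (D t) * enorm v)) =
    gamma * (c * spnorm H) * enorm v * enorm (D t) ^+ 2 * (enorm (D t) / 2) by field.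
have -> : gamma * (2 * (c * spnorm H)) * enorm v * enorm (D t) ^+ 2 =
    gamma * (c * spnorm H) * enorm v * enorm (D t) ^+ 2 * 2 by ring.
rewrite ler_wpM2l//; last by lra.
by rewrite !mulr_ge0 ?sqr_ge0 ?enorm_ge0 ?spnorm_ge0// ltW ?gamma_gt0.
Qed.

Lemma bias_le M2 : spnorm H <= M2 ->
  enorm (psi - grad Z p - - (dot (grad Z p) (ones n) / n%:R) *: ones n) <=
    2 * (n%:R * c * M2 + n%:R * c ^+ 2 * L2).
Proof.
move=> HM.
have nc0 : 0 <= n%:R * c by rewrite mulr_ge0// ltW.
have M0 : 0 <= M2 := le_trans (spnorm_ge0 _) HM.
apply: enorm_le_dual => [|v].
  by rewrite !mulr_ge0// addr_ge0// mulr_ge0// mulr_ge0// sqr_ge0.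
rewrite dot_biasE (le_trans (lerD (int_rem_le v) (int_quad_le v)))//.
rewrite -mulrDl ler_wpM2r ?enorm_ge0//.
have : n%:R * c * spnorm H <= n%:R * c * M2 by rewrite ler_wpM2l.
nra.
Qed.

(** Expanded in coordinates, the quadratic term is a triple sum of third moments. These all equal
    [mu], so it collapses to the part of [epsilon_0] containing [mu], and only the Taylor remainder
    survives. *)
Lemma bias_centered_le mu :
  (forall i j k, \int[P]_t (D t i 0 * D t j 0 * score gamma p (delta t) k 0) = mu) ->
  enorm (psi - grad Z p - (c * mu / 2 * dot (ones n) (H *m ones n)
         - dot (grad Z p) (ones n) / n%:R) *: ones n) <=
    2 * (n%:R * c ^+ 2 * L2).
Proof.
move=> MC3; apply: enorm_le_dual => [|v].
  by rewrite mulr_ge0// mulr_ge0// mulr_ge0// sqr_ge0.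
have -> : psi - grad Z p - (c * mu / 2 * dot (ones n) (H *m ones n)
         - dot (grad Z p) (ones n) / n%:R) *: ones n =
    psi - grad Z p - - (dot (grad Z p) (ones n) / n%:R) *: ones n
    - (c * mu / 2 * dot (ones n) (H *m ones n)) *: ones n.
  by rewrite -[RHS]addrA -opprD -scalerDl [- _ + _]addrC.
rewrite dotDl dotNl dotZl dot_biasE.
have -> : \int[P]_t (dot (D t) (H *m D t) * (gamma * dot (D t) v)) =
    mu * dot (ones n) (H *m ones n) * dot (ones n) v.
  have bmS k : bounded_measurable (fun t => score gamma p (delta t) k 0).
    have := bm_scale gamma (bmD k).
    by congr bounded_measurable; apply/funext => t; rewrite /score /D !mxE.
  have sm i j k : in_L1 P
      (fun t => D t i 0 * D t j 0 * score gamma p (delta t) k 0).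
    by apply: bm1; apply: bounded_measurableM => //; exact: bounded_measurableM.
  transitivity (\int[P]_t (\sum_i \sum_j \sum_k H i j * v k 0 *
      (D t i 0 * D t j 0 * score gamma p (delta t) k 0))).
    apply: eq_Rintegral => t _; rewrite !dotE mulr_suml; apply: eq_bigr => i _.
    rewrite [(H *m _) i 0]mxE mulr_sumr mulr_suml; apply: eq_bigr => j _.
    rewrite !mulr_sumr; apply: eq_bigr => k _; rewrite /score /D !mxE; ring.
  have s2 i j : in_L1 P (fun t => \sum_k H i j * v k 0 *
      (D t i 0 * D t j 0 * score gamma p (delta t) k 0)).
    by apply: in_L1_sum => k; exact: in_L1Zl.
  rewrite Rintegral_sum; last by move=> i; exact: in_L1_sum.
  rewrite !dotE [mu * _]mulr_sumr mulr_suml; apply: eq_bigr => i _.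
  rewrite Rintegral_sum// !mxE mul1r [mu * _]mulr_sumr mulr_suml; apply: eq_bigr => j _.
  rewrite Rintegral_sum; last by move=> k; exact: in_L1Zl.
  rewrite mulr_sumr; apply: eq_bigr => k _.
  rewrite Rintegral_L1Zl// MC3 !mxE; ring.
have := int_rem_le v; set I := \int[P]_t _; set h := dot (ones n) (H *m _).
set w := dot (ones n) v => Ile.
have -> : I + c / 2 * (mu * h * w) - c * mu / 2 * h * w = I by field.
by rewrite (le_trans Ile)// ler_wpM2r ?enorm_ge0//; nra.
Qed.

End Bias.

(** * Moments of one sample *)

(** The bridge between the space of [delta], which carries the moment conditions, and the space of
    the copies and noises. *)
Lemma Rintegral_same_law {R : realType} d0 d1 d2 (T0 : measurableType d0)
    (T1 : measurableType d1) (S : measurableType d2) (P0 : probability T0 R)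
    (P1 : probability T1 R) (X0 : {RV P0 >-> S}) (X1 : {RV P1 >-> S}) (g : S -> R) :
  (forall A, measurable A -> distribution P1 X1 A = distribution P0 X0 A) ->
  measurable_fun setT g -> in_L1 P0 (g \o X0) -> in_L1 P1 (g \o X1) ->
  \int[P1]_t g (X1 t) = \int[P0]_t g (X0 t).
Proof.
move=> law mg g0 g1; congr fine.
have mEg : measurable_fun setT (EFin \o g) by exact/measurable_EFinP.
rewrite -(integral_distribution mEg g1) -(integral_distribution mEg g0).
apply: eq_measure_integral => A mA _; exact: law.
Qed.

Section SegmentMeasurable.
Context {R : realType} {n : nat} (p : 'cV[R]_n) (c : R).

Let q_ (x : 'cV[R]_n) := (1 - c) *: p + c *: x.

Lemma measurable_segment :
  measurable_fun setT (q_ : borel_cV R n -> borel_cV R n).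
Proof.
apply: continuous_measurable_borel_cV => x.
apply: (@cvgD _ _ _ _ _ (fun=> (1 - c) *: p) (fun y => c *: y)).
- exact: nbhs_filter.
- exact: cst_continuous.
- exact: scaler_continuous.
Qed.

Lemma simplex_segment_point x : simplex p -> simplex x -> 0 <= c <= 1 ->
  simplex (q_ x).
Proof.
move=> sp sx c01; have -> : q_ x = p + c *: (x - p).
  by rewrite /q_ scalerBl scale1r scalerBr addrA addrAC.
exact: simplex_segment.
Qed.

(** Off the simplex [Z] is arbitrary, so only its extension by zero is measurable on the whole
    space. *)
Lemma measurable_restrict_segment (Z : 'cV[R]_n -> R) :
  {within simplex, continuous Z} ->
  measurable_fun setT (fun x : borel_cV R n => (Z \_ simplex) (q_ x)).
Proof.
move=> Zc; apply: (measurableT_comp (f := Z \_ simplex : borel_cV R n -> R)) measurable_segment.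
apply/(measurable_restrictT _ measurable_simplex).
exact: subspace_continuous_measurable_cV measurable_simplex Zc.
Qed.

End SegmentMeasurable.

Section Sample.
Context {R : realType} {n : nat} {d dX : measure_display} {T : measurableType d}
  {X : measurableType dX} (P : probability T R).
Variables (U : T -> borel_cV R n) (xi : T -> X) (zeta : 'cV[R]_n -> X -> R)
  (Z : 'cV[R]_n -> R) (p : 'cV[R]_n) (c sigma2 M0 : R).
Hypothesis mU : measurable_fun setT U.
Hypothesis mxi : measurable_fun setT xi.
Hypothesis Uxi : independent2 P U xi.
Hypothesis mzeta : measurable_fun [set x : borel_cV R n * X | simplex x.1]
  (fun x => zeta x.1 x.2).
Hypothesis zetaE : forall q, simplex q ->
  ('E_P[(fun t => zeta q (xi t))] = (Z q)%:E)%E.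
Hypothesis zetaV : forall q, simplex q ->
  ('V_P[(fun t => zeta q (xi t))] <= sigma2%:E)%E.
Hypothesis ZM0 : forall q, simplex q -> `|Z q| <= M0.
Hypothesis sp : simplex p.
Hypothesis c01 : 0 <= c <= 1.
Hypothesis sU : forall t, simplex (U t).

Let q_ (x : 'cV[R]_n) := (1 - c) *: p + c *: x.

Let mS : measurable [set y : borel_cV R n * X | simplex y.1].
Proof.
have := @measurable_fst _ _ (borel_cV R n) X measurableT _ measurable_simplex.
by rewrite setTI.
Qed.

(* Outside the simplex [zeta] need not be measurable, so it is cut off there. *)
Definition cutoff (z : borel_cV R n * X) : R :=
  ((fun y => zeta y.1 y.2) \_ [set y : borel_cV R n * X | simplex y.1]) (q_ z.1, z.2).

Lemma measurable_cutoff : measurable_fun setT cutoff.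
Proof.
have mZ := (measurable_restrictT _ mS).1 mzeta.
apply: (measurableT_comp mZ); apply: measurable_fun_pair => //.
by apply: measurableT_comp => //; exact: measurable_segment.
Qed.

Lemma cutoffE x w : simplex x -> cutoff (x, w) = zeta (q_ x) w.
Proof.
move=> sx; rewrite /cutoff patchE mem_set//=; exact: simplex_segment_point.
Qed.

Let second q : simplex q -> in_L2 P (fun t => zeta q (xi t)) /\
  \int[P]_t (zeta q (xi t) ^+ 2) <= sigma2 + M0 ^+ 2.
Proof.
move=> sq.
have mq : measurable_fun setT (fun t => zeta q (xi t)).
  have -> : (fun t => zeta q (xi t)) =
      ((fun y => zeta y.1 y.2) \_ [set y : borel_cV R n * X | simplex y.1]) \o
      (fun t => (q : borel_cV R n, xi t)).
    by apply/funext => t; rewrite /= patchE mem_set.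
  have mZ := (measurable_restrictT _ mS).1 mzeta.
  by apply: (measurableT_comp mZ); exact: measurable_fun_pair.
have [z2 zi] := second_moment mq (zetaE sq) (zetaV sq).
split=> //; rewrite (le_trans zi)// lerD2l -(real_normK (num_real (Z q))).
by rewrite ler_sqr ?nnegrE ?ZM0// (le_trans _ (ZM0 sq)).
Qed.

Let mpair : measurable_fun setT (fun t => (U t, xi t)).
Proof. exact: measurable_fun_pair. Qed.

Let mW : measurable_fun setT (fun t => cutoff (U t, xi t)).
Proof. by apply: (measurableT_comp measurable_cutoff). Qed.

(** With [U] fixed, the noise contributes at most [sigma2 + M0 ^+ 2], whatever the point. The
    estimate is made in the extended reals, so that integrability is a result of it. *)
Lemma sample_second_moment (b : borel_cV R n -> R) :
  measurable_fun setT b -> (forall x, 0 <= b x) ->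
  in_L1 P (b \o U) ->
  in_L1 P (fun t => cutoff (U t, xi t) ^+ 2 * b (U t)) /\
  \int[P]_t (cutoff (U t, xi t) ^+ 2 * b (U t)) <=
    (sigma2 + M0 ^+ 2) * \int[P]_t b (U t).
Proof.
move=> mb b0 b1.
pose f (z : borel_cV R n * X) := cutoff z ^+ 2 * b z.1.
have mf : measurable_fun setT f.
  apply: measurable_funM; first exact: measurable_funX measurable_cutoff.
  exact: measurableT_comp.
have f0 z : 0 <= f z by rewrite mulr_ge0// sqr_ge0.
have mEf : measurable_fun setT (EFin \o f) by exact/measurable_EFinP.
have le : (\int[P]_t (f (U t, xi t))%:E <=
    ((sigma2 + M0 ^+ 2) * \int[P]_t b (U t))%:E)%E.
  rewrite (ge0_decoupling mU mxi Uxi mEf (fun z => f0 z)).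
  rewrite -Rintegral_L1Zl// -Rintegral_expectation; last exact: in_L1Zl.
  rewrite unlock; apply: ge0_le_integral => //.
  - by move=> t _; apply: integral_ge0 => s _; exact: f0.
  - exact: measurable_integral_decoupled mEf (fun z => f0 z).
  - by apply/measurable_EFinP/measurable_funM => //; exact: measurableT_comp.
  move=> t _; have sq := simplex_segment_point sp (sU t) c01.
  have [[mz z2] zi] := second sq.
  rewrite /f /=; under eq_integral => s _ do rewrite cutoffE//.
  rewrite -[X in (X <= _)%E](_ : (\int[P]_s (b (U t) * zeta (q_ (U t)) (xi s) ^+ 2))%R%:E = _).
    by rewrite Rintegral_L1Zl// lee_fin mulrC ler_wpM2r.
  rewrite -Rintegral_expectation ?unlock; last exact: in_L1Zl.
  by apply: eq_integral => s _; rewrite mulrC.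
have f1 : in_L1 P (fun t => f (U t, xi t)).
  apply/integrableP; split; first by apply/measurable_EFinP; exact: (measurableT_comp mf).
  under eq_integral => t _ do rewrite /= ger0_norm//.
  by rewrite (le_lt_trans le)// ltry.
split=> //; rewrite -lee_fin -Rintegral_expectation//.
by rewrite unlock.
Qed.

Lemma sample_in_L2 (a : borel_cV R n -> R) M : measurable_fun setT a ->
  (forall t, `|a (U t)| <= M) ->
  in_L2 P (fun t => cutoff (U t, xi t) * a (U t)).
Proof.
move=> ma aM; apply: (@in_L2_mul_bounded _ _ _ _ _ _ M) => //; last exact: measurableT_comp.
(* The constant weight 1 yields the square integrability of the bare evaluation. *)
split=> //; have := (sample_second_moment (b := fun=> 1) _ _ _).1.
under [in X in _ -> X]eq_fun do rewrite -[_ ^+ 2]mulr1.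
apply => //; exact: in_L2_L1 (in_L2_cst P 1).
Qed.

(** Unbiasedness at each fixed point, integrated over the random point: the inner integral over the
    noise replaces the evaluation by [Z]. *)
Lemma sample_mean (a : borel_cV R n -> R) M : measurable_fun setT a ->
  (forall t, `|a (U t)| <= M) ->
  \int[P]_t (cutoff (U t, xi t) * a (U t)) = \int[P]_t (Z (q_ (U t)) * a (U t)).
Proof.
move=> ma aM.
pose f (z : borel_cV R n * X) := cutoff z * a z.1.
have mf : measurable_fun setT f.
  by apply: measurable_funM; [exact: measurable_cutoff|exact: measurableT_comp].
have q1 t : in_L1 P (fun s => zeta (q_ (U t)) (xi s)).
  by apply: in_L2_L1; case: (second (simplex_segment_point sp (sU t) c01)).
have fE t s : f (U t, xi s) = a (U t) * zeta (q_ (U t)) (xi s).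
  by rewrite /f cutoffE// mulrC.
rewrite (Rintegral_decoupling mU mxi Uxi mf).
- apply: eq_Rintegral => t _; under eq_Rintegral do rewrite fE.
  rewrite Rintegral_L1Zl// (expectation_Rintegral (zetaE _)) 1?mulrC//.
  exact: simplex_segment_point.
- exact: in_L2_L1 (sample_in_L2 ma aM).
- by move=> t; under eq_fun do rewrite fE; exact: in_L1Zl.
Qed.

End Sample.

Theorem theorem1 (R : realType) :
  exists K : R,
  forall (n : nat) (Z : 'cV[R]_n -> R) (L0 L1 L2 sigma : R)
    (p : 'cV[R]_n) (c gamma : R) (N : nat)
    (* delta, on its own probability space *)
    (d0 : measure_display) (T0 : measurableType d0) (P0 : probability T0 R)
    (delta : {RV P0 >-> borel_cV R n})
    (* its copies deltas j, and the random elements xi j on which the random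
       functions Zhat j depend *)
    (d : measure_display) (T : measurableType d) (P : probability T R)
    (deltas : 'I_N -> {RV P >-> borel_cV R n})
    (dX : measure_display) (X : measurableType dX)
    (xi : 'I_N -> {RV P >-> X})
    (zeta : 'I_N -> 'cV[R]_n -> X -> R),
  let Zhat j q t := zeta j q (xi j t) in
  let M0 := sup [set `|Z q| | q in simplex] in
  let M2 := sup [set spnorm (hess Z q) | q in simplex] in
  let psi_hat := sfe p c gamma Zhat (fun j t => deltas j t) in
  (1 < n)%N ->
  (* smoothness of Z *)
  simplex_Ck 2 Z ->
  simplex_lipschitz Num.norm L0 Z ->
  simplex_lipschitz (@enorm R n) L1 (grad Z) ->
  simplex_lipschitz (@spnorm R n n) L2 (hess Z) ->
  (* noisy evaluations *)
  0 < sigma ->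
  (forall j, measurable_fun [set x : borel_cV R n * X | simplex x.1]
               (fun x => zeta j x.1 x.2)) ->
  (forall j q, simplex q -> ('E_P[Zhat j q] = (Z q)%:E)%E) ->
  (forall j q, simplex q -> ('V_P[Zhat j q] <= (sigma ^+ 2)%:E)%E) ->
  (* parameters *)
  simplex p -> 0 < c <= 1 -> (0 < N)%N ->
  (* delta takes values in the simplex and satisfies (MC1) and (MC2) *)
  (forall t, simplex (delta t)) ->
  has_mean P0 (fun t => score gamma p (delta t)) 0 ->
  (exists lambda : R,
     has_mean P0 (fun t => (delta t - p : 'cV[R]_n) *m (score gamma p (delta t))^T)
       (1%:M - lambda *: (ones n *m (ones n)^T))) ->
  (* copies of delta; mutual independence of all copies and all noises *)
  (forall j t, simplex (deltas j t)) ->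
  (forall j (A : set (borel_cV R n)), measurable A ->
     distribution P (deltas j) A = distribution P0 delta A) ->
  mutually_independent P (fun s : 'I_N + 'I_N =>
    match s with
    | inl j => sigma_of (deltas j)
    | inr j => sigma_of (xi j)
    end) ->
  exists psi : 'cV[R]_n,
    has_mean P psi_hat psi /\
    (let eps0 := - (dot (grad Z p) (ones n) / n%:R) in
     enorm (psi - grad Z p - eps0 *: ones n)
       <= K * (n%:R * c * M2 + n%:R * c ^+ 2 * L2)) /\
    ('E_P[(fun t => enorm (psi_hat t - psi) ^+ 2)%R]
       <= (K * (gamma * n%:R / (N%:R * c ^+ 2) * (sigma ^+ 2 + M0 ^+ 2)))%:E)%E /\
    (* under (MC3) *)
    (forall mu : R,
       (forall i j k : 'I_n,
          ('E_P0[(fun t => (delta t - p : 'cV[R]_n) i 0 *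
                           (delta t - p : 'cV[R]_n) j 0 *
                           score gamma p (delta t) k 0)%R] = mu%:E)%E) ->
       let eps0 := c * mu / 2 * dot (ones n) (hess Z p *m ones n)
                   - dot (grad Z p) (ones n) / n%:R in
       enorm (psi - grad Z p - eps0 *: ones n)
         <= K * (n%:R * c ^+ 2 * L2)).
Proof.
(* The constant 2 is the bound on [|delta - p|^2] in the Taylor remainder; the variance estimate
   only needs [n - 1 <= 2 n]. *)
exists 2 => n Z L0 L1 L2 sigma p c gamma N d0 T0 P0 delta d T P deltas dX X xi zeta.
move=> Zhat M0 M2 psi_hat n1 Z2 ZL0 _ ZL2 _ mzeta zetaE zetaV sp c01 N0 sdelta.
move=> MC1 [lambda MC2] sdeltas law indep.
have mdelta : measurable_fun setT (delta : T0 -> borel_cV R n).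
  exact: measurable_funP.
have mdeltas j : measurable_fun setT (deltas j : T -> borel_cV R n).
  exact: measurable_funP.
have mxi j : measurable_fun setT (xi j : T -> X) by exact: measurable_funP.
have gamma0 := gamma_gt0 n1 mdelta sp sdelta MC2.
have c0 : 0 < c by case/andP: c01.
have c01' : 0 <= c <= 1 by rewrite ltW//; case/andP: c01.
pose q (x : 'cV[R]_n) := (1 - c) *: p + c *: x.
have sq x : simplex x -> simplex (q x).
  by move=> sx; exact: simplex_segment_point.
have ZM0 x : simplex x -> `|Z x| <= M0.
  move=> sx; apply: (ub_le_sup (simplex_lipschitz_has_ubound _ ZL0)); last by exists x.
  exact: ler_normD.
have HM2 : spnorm (hess Z p) <= M2.
  apply: (ub_le_sup (simplex_lipschitz_has_ubound _ ZL2)); last by exists p.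
  exact: ler_spnormD.
pose g (x : borel_cV R n) := (Z \_ simplex) (q x).
have mg : measurable_fun setT g by apply: measurable_restrict_segment; case: Z2.
have gE x : simplex x -> g x = Z (q x).
  by move=> sx; rewrite /g patchE mem_set//; exact: sq.
(* The score with the factor [1 / c] absorbed: coordinate [k] of a summand is the evaluation times
   [a k], a bounded weight depending on the copy alone. *)
pose a k (x : borel_cV R n) := gamma / c * ((x : 'cV[R]_n) k 0 - p k 0).
have ma k : measurable_fun setT (a k).
  apply: measurable_funM => //; apply: measurable_funB => //.
  exact: measurable_coord.
have aM k x : simplex x -> `|a k x| <= gamma / c.
  move=> sx; have gc : 0 <= gamma / c by rewrite divr_ge0// ltW.
  rewrite /a normrM ger0_norm// ler_piMr//.
  have := sx.2 k; have := simplex_le1 k sx; have := sp.2 k; have := simplex_le1 k sp.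
  by rewrite ler_norml; lra.
have scoreE k (x : 'cV[R]_n) (z : R) : z / c * score gamma p x k 0 = z * a k x.
  by rewrite /score /a !mxE; field; rewrite gt_eqF.
(* Defined without noise on the space of [delta], where the bias lemmas apply; [Ym] identifies it
   with the mean of every summand on the other space. *)
pose psi : 'cV[R]_n := \col_k \int[P0]_t
  (Z (q (delta t)) / c * score gamma p (delta t) k 0).
have psiE k : psi k 0 = \int[P0]_t
    (Z (q (delta t)) / c * score gamma p (delta t) k 0) by rewrite mxE.
have bmZ : bounded_measurable (fun t => Z (q (delta t))).
  split; last by exists M0 => t; exact/ZM0/sq.
  have -> : (fun t => Z (q (delta t))) = g \o delta.
    by apply/funext => t; rewrite /= gE.
  exact: measurableT_comp.
pose W j t := cutoff (zeta j) p c (deltas j t, xi j t).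
pose Y k j t := W j t * a k (deltas j t).
have indj j := mutually_independent_diag indep j.
have Y2 k j : in_L2 P (Y k j).
  apply: (sample_in_L2 (mdeltas j) (mxi j) (indj j) (mzeta j) (zetaE j)
    (zetaV j) ZM0 sp c01' (sdeltas j) (ma k)) => t; exact: aM.
have Ym k j : \int[P]_t Y k j t = psi k 0.
  rewrite (sample_mean (mdeltas j) (mxi j) (indj j) (mzeta j) (zetaE j)
    (zetaV j) ZM0 sp c01' (sdeltas j) (ma k) (fun t => aM k _ (sdeltas j t))).
  rewrite psiE; under [RHS]eq_Rintegral do rewrite scoreE -gE//.
  under eq_Rintegral do rewrite -/(q _) -gE//.
  have ga : measurable_fun setT (fun x => g x * a k x) by exact: measurable_funM.
  have gaM x : simplex x -> `|g x * a k x| <= M0 * (gamma / c).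
    by move=> sx; rewrite normrM ler_pM// ?aM// gE// ZM0//; exact: sq.
  apply: (Rintegral_same_law (X0 := delta) (X1 := deltas j) (law j) ga).
  - apply: (@in_L1_bounded _ _ _ _ _ (M0 * (gamma / c))) => [|t]; last exact: gaM.
    exact: measurableT_comp.
  - apply: (@in_L1_bounded _ _ _ _ _ (M0 * (gamma / c))) => [|t]; last exact: gaM.
    exact: measurableT_comp.
have Yc k j l : j != l -> \int[P]_t (Y k j t * Y k l t) = psi k 0 ^+ 2.
  move=> jl; rewrite expr2 -{1}(Ym k j) -(Ym k l).
  apply: Rintegral_mul_independent; last 3 first.
  - exact: in_L2_L1.
  - exact: in_L2_L1.
  - exact: in_L2M.
  have my i : measurable_fun setT (fun z : borel_cV R n * X =>
      cutoff (zeta i) p c z * a k z.1).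
    by apply: measurable_funM; [exact: measurable_cutoff|exact: measurableT_comp].
  (* Distinct summands are measurable functions of independent pairs, the cutoff being jointly
     measurable. *)
  exact: independent2_comp (mutually_independent_pairs mdeltas mxi indep jl) (my j) (my l).
have sfeE t k : psi_hat t k 0 = N%:R^-1 * \sum_j Y k j t.
  rewrite /psi_hat /sfe mxE summxE; congr (_ * _); apply: eq_bigr => j _.
  by rewrite mxE scoreE /Y /W cutoffE.
have mom k := sample_mean_moments N0 (Y2 k) (Ym k) (Yc k).
exists psi; split; [|split; [|split]].
- move=> k i; rewrite ord1; have [h2 hE _] := mom k.
  under eq_fun do rewrite sfeE.
  by rewrite Rintegral_expectation ?hE//; exact: in_L2_L1.
- exact: (bias_le n1 mdelta sp sdelta MC1 MC2 Z2 ZL2 c01 bmZ psiE HM2).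
- have s1 k : in_L1 P (fun t => (psi_hat t k 0 - psi k 0) ^+ 2).
    have [h2 _ _] := mom k.
    have := (in_L2D h2 (in_L2_cst P (- psi k 0))).2.
    by congr in_L1; apply/funext => t; rewrite sfeE.
  have -> : (fun t => enorm (psi_hat t - psi) ^+ 2) =
      (fun t => \sum_k (psi_hat t k 0 - psi k 0) ^+ 2).
    apply/funext => t; rewrite sqr_enorm dotE; apply: eq_bigr => k _.
    by rewrite !mxE -expr2.
  rewrite Rintegral_expectation; last exact: in_L1_sum.
  rewrite lee_fin Rintegral_sum//.
  have msek k : \int[P]_t (psi_hat t k 0 - psi k 0) ^+ 2 <=
      N%:R^-1 ^+ 2 * \sum_j \int[P]_t (Y k j t ^+ 2).
    have [_ _ h] := mom k; apply: le_trans h.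
    by under eq_Rintegral do rewrite sfeE.
  rewrite (le_trans (ler_sum _ (fun k _ => msek k)))// -mulr_sumr exchange_big/=.
  have S0 : 0 <= sigma ^+ 2 + M0 ^+ 2 by rewrite addr_ge0 ?sqr_ge0.
  (* Summing over the coordinates is essential: the weights add up to [(gamma / c)^2 |D|^2], whose
     mean trades one power of [gamma] for [n - 1]. *)
  have one j : \sum_k \int[P]_t (Y k j t ^+ 2) <=
      (sigma ^+ 2 + M0 ^+ 2) * (gamma / c ^+ 2 * (n%:R - 1)).
    have ma2 k : measurable_fun setT (fun x => a k x ^+ 2) by exact: measurable_funX.
    have a2 k x : simplex x -> `|a k x ^+ 2| <= (gamma / c) ^+ 2.
      move=> sx; rewrite normrX ler_sqr ?aM// nnegrE//.
      by rewrite divr_ge0// ltW.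
    have s2 k i : in_L1 P (fun t => a k (deltas i t) ^+ 2).
      apply: (@in_L1_bounded _ _ _ _ _ ((gamma / c) ^+ 2)) => [|t]; last exact: a2.
      exact: (measurableT_comp (ma2 k)).
    have s20 k : in_L1 P0 (fun t => a k (delta t) ^+ 2).
      apply: (@in_L1_bounded _ _ _ _ _ ((gamma / c) ^+ 2)) => [|t]; last exact: a2.
      exact: (measurableT_comp (ma2 k)).
    apply: (@le_trans _ _ (\sum_k (sigma ^+ 2 + M0 ^+ 2) *
        \int[P0]_t (a k (delta t) ^+ 2))).
      apply: ler_sum => k _.
      rewrite -(Rintegral_same_law (law j) (ma2 k) (s20 k) (s2 k j)).
      have [_] := sample_second_moment (mdeltas j) (mxi j) (indj j) (mzeta j)
        (zetaE j) (zetaV j) ZM0 sp c01' (sdeltas j) (ma2 k)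
        (fun x => sqr_ge0 (a k x)) (s2 k j).
      by apply: le_trans; under eq_Rintegral do rewrite /Y exprMn.
    rewrite -mulr_sumr ler_wpM2l// -Rintegral_sum//.
    rewrite -(mean_sqr_enorm n1 mdelta sp sdelta MC2).
    have -> : gamma / c ^+ 2 * (gamma * \int[P0]_t enorm (delta t - p) ^+ 2) =
        (gamma / c) ^+ 2 * \int[P0]_t enorm (delta t - p) ^+ 2.
      by field; rewrite gt_eqF.
    rewrite -Rintegral_L1Zl.
      rewrite le_eqVlt; apply/orP; left; apply/eqP/eq_Rintegral => t _; rewrite sqr_enorm dotE mulr_sumr.
      by apply: eq_bigr => k _; rewrite /a !mxE; ring.
    apply: (@in_L1_bounded _ _ _ _ _ 2) => [|t]; last first.
      by rewrite ger0_norm ?sqr_ge0//; exact: sqr_enorm_simplexB.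
    under eq_fun do rewrite sqr_enorm dotE.
    apply: measurable_sum => k; under eq_fun do rewrite !mxE.
    by apply: measurable_funM; apply: measurable_funB => //;
      exact: (measurableT_comp (measurable_coord k) mdelta).
  have Nn0 : N%:R != 0 :> R by rewrite pnatr_eq0 -lt0n.
  rewrite (le_trans (ler_wpM2l (sqr_ge0 _) (ler_sum _ (fun j _ => one j))))//.
  rewrite sumr_const card_ord -(mulr_natl (_ * _)).
  have -> : N%:R^-1 ^+ 2 * (N%:R * ((sigma ^+ 2 + M0 ^+ 2) * (gamma / c ^+ 2 * (n%:R - 1)))) =
      gamma / (N%:R * c ^+ 2) * (sigma ^+ 2 + M0 ^+ 2) * (n%:R - 1).
    by field; rewrite Nn0 gt_eqF.
  have -> : 2 * (gamma * n%:R / (N%:R * c ^+ 2) * (sigma ^+ 2 + M0 ^+ 2)) =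
      gamma / (N%:R * c ^+ 2) * (sigma ^+ 2 + M0 ^+ 2) * (2 * n%:R).
    by field; rewrite Nn0 gt_eqF.
  apply: ler_wpM2l; last by have := ler0n R n; lra.
  by rewrite mulr_ge0// divr_ge0// ?mulr_ge0 ?sqr_ge0// ltW.
- move=> mu MC3; apply: (bias_centered_le n1 mdelta sp sdelta MC1 MC2 Z2 ZL2 c01 bmZ psiE).
  by move=> i j k; apply: expectation_Rintegral; exact: MC3.
Qed.
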